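(* Let $\mathfrak T(u)$ be the free Heisenberg twain algebra over the field $\mathbb Q^\pi$ and the rational Heisenberg group $H_{\mathbb Q}$ on one generator $u$, and let $\langle\mathcal R_u\rangle\subset\mathfrak T(u)$ be the twain Heisenberg ideal generated by $$\mathcal R_u=\mathcal R_u(\Gamma,\star)\cup\mathcal R_u(G,\cdot)\cup\mathcal R_u(\star,\cdot).$$ Then the rational Gaussian closure $\overline{\mathcal G(\mathbb Q)}$ is isomorphic, as a Heisenberg twain algebra, to $\mathfrak T(u)/\langle\mathcal R_u\rangle$ via the isomorphism induced by $g\leftrightarrow u$, where $g(x)=e^{-\pi x^2}$ is the unit Gaussian.
   Context: $\tau=2\pi$; all algebras are associative and commutative but not necessarily unital. $\mathbb Q^\pi:=\mathbb Q(e^{\pi\xi}\mid\xi\in\mathbb Q(i))\subset\mathbb C$; it contains all roots of unity and hence all square roots of rationals. $H_{\mathbb Q}$ consists of all $c(x,\xi)$ with $c\in\mathbb T_{\mathbb Q}$ (the group of roots of unity), $x\in G:=\mathbb Q$, $\xi\in\Gamma:=\mathbb Q$, with product $c(x,\xi)c'(x',\xi')=cc'e^{i\tau\xi x'}(x+x',\xi+\xi')$. Elements $\mu\in G$ and $\alpha\in\Gamma$ are identified with $1(\mu,0)$ and $1(0,\alpha)$. A Heisenberg twain algebra (over $\mathbb Q^\pi$ and $H_{\mathbb Q}$) is a $\mathbb Q^\pi$-vector space $A$ with two bilinear products $\star$ and $\cdot$, each making $A$ an algebra, and a linear left action $\bullet$ of $H_{\mathbb Q}$ such that roots of unity $c$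 act as multiplication by $c\in\mathbb Q^\pi$ and, for all $a,b\in A$, $x\in G$, $\xi\in\Gamma$: $x\bullet(a\star b)=(x\bullet a)\star b$, $\xi\bullet(a\star b)=(\xi\bullet a)\star(\xi\bullet b)$, $\xi\bullet(a\cdot b)=(\xi\bullet a)\cdot b$, $x\bullet(a\cdot b)=(x\bullet a)\cdot(x\bullet b)$. Morphisms are equivariant linear maps respecting both products. $\mathfrak T(u)$ is the free object on the singleton $\{u\}$: for every Heisenberg twain algebra $A$ and $a\in A$ there is a unique morphism $\mathfrak T(u)\to A$ with $u\mapsto a$. A twain Heisenberg ideal is a linear subspace that is an ideal for both products and closed under $H_{\mathbb Q}$. $\overline{\mathcal G(\mathbb Q)}$ is the $\mathbb Q^\pi$-linear span of all functions $e_\alpha g_{\mu,\rho}$ on $\mathbb R$, $\alpha,\mu\in\mathbb Q$, $\rho\in\mathbb Q_{>0}$, with $e_\alpha(x)=e^{i\tau\alpha x}$, $g_{\mu,\rho}(x)=e^{-\pi\rho(x-\mu)^2}$; its products are convolution $\star$ and pointwise product $\cdot$, and $H_{\mathbb Q}$ acts by $(x\bullet s)(y)=s(y-x)$, $(\xi\bullet s)(y)=e^{i\tau\xi y}s(y)$. Relations. For $\rho=n/m\in\mathbb Q_{>0}$ in lowest terms ($n,m\in\mathbb Z_{>0}$) put $u_\rho:=\sqrt{m\,n^{m-1}}\,(u^n)^{\star m}$, where $u^n$ is the $n$-fold power for $\cdot$ and $(\ )^{\star m}$ the $m$-fold power for $\star$. Write $\rho\boxplus\rho':=\rho\rho'/(\rho+\rho')$.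 Then: $$\mathcal R_u(\Gamma,\star)=\Big\{(\alpha\bullet u_\rho)\star(\alpha'\bullet u_{\rho'})-\tfrac{e^{-\pi(\alpha-\alpha')^2/(\rho+\rho')}}{\sqrt{\rho+\rho'}}\,\Big(\tfrac{\alpha\rho'+\alpha'\rho}{\rho+\rho'}\bullet u_{\rho\boxplus\rho'}\Big)\Big\}$$ with $\alpha,\alpha'\in\Gamma$, $\rho,\rho'\in\mathbb Q_{>0}$ (the coefficient $\tfrac{\alpha\rho'+\alpha'\rho}{\rho+\rho'}$ being an element of $\Gamma$); $$\mathcal R_u(G,\cdot)=\Big\{(\mu\bullet u_\rho)\cdot(\mu'\bullet u_{\rho'})-e^{-\pi(\rho\boxplus\rho')(\mu-\mu')^2}\,\Big(\tfrac{\mu\rho+\mu'\rho'}{\rho+\rho'}\bullet u_{\rho+\rho'}\Big)\Big\}$$ with $\mu,\mu'\in G$, $\rho,\rho'\in\mathbb Q_{>0}$ (the coefficient $\tfrac{\mu\rho+\mu'\rho'}{\rho+\rho'}$ being an element of $G$); $$\mathcal R_u(\star,\cdot)=\Big\{(u^{\star m})^n-\sqrt{n^{m-1}/m^{n-1}}\;(u^n)^{\star m}\;\Big|\;n,m\in\mathbb Z_{>0}\Big\}.$$ *)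

(* Defs.v *)
From HB Require Import structures.
From mathcomp Require Import all_boot all_order all_algebra.
From mathcomp Require Import generic_quotient ring_quotient.
From mathcomp Require Import all_classical all_reals all_analysis.
From mathcomp Require Import complex.
From mathcomp Require Import ring lra zify.

Set Implicit Arguments.
Unset Strict Implicit.
Unset Printing Implicit Defensive.

Import Order.TTheory GRing.Theory Num.Theory.

Local Open Scope ring_scope.
Local Open Scope complex_scope.

Definition cexp (R : realType) (z : R[i]) : R[i] :=
  let: a +i* b := z in (expR a * cos b) +i* (expR a * sin b).

Section ComplexExponential.
Variable R : realType.
Implicit Types z w : R[i].

Lemma cexp0 : cexp (0 : R[i]) = 1.
Proof. by rewrite /cexp /= expR0 cos0 sin0 mulr0 mulr1. Qed.

Lemma cexpD z w : cexp (z + w) = cexp z * cexp w.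
Proof.
case: z w => [a b] [c d] /=; rewrite expRD cosD sinD.
by apply/eqP; rewrite eq_complex /=; apply/andP; split; apply/eqP; ring.
Qed.

Lemma cexpX z n : cexp z ^+ n = cexp (z *+ n).
Proof.
by elim: n => [|n IH]; rewrite ?mulr0n ?cexp0 // exprS IH mulrS cexpD.
Qed.

Lemma cexpR (x : R) : cexp x%:C = (expR x)%:C.
Proof. by rewrite /cexp /= cos0 sin0 mulr0 mulr1. Qed.

End ComplexExponential.

Section Qpi.
Variable R : realType.

(* [divringClosed] subsets of a field are its subfields. *)
Definition Qpi_pred : {pred R[i]} := fun z =>
  `[< forall K : divringClosed R[i],
        (forall a b : rat, cexp (pi%:C * (ratr a +i* ratr b)) \in K) -> z \in K >].

Fact Qpi_divring_closed : divring_closed Qpi_pred.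
Proof.
split.
- by apply/asboolP => K _; rewrite rpred1.
- by move=> x y /asboolP xP /asboolP yP; apply/asboolP => K HK;
    rewrite rpredB ?xP ?yP.
- by move=> x y /asboolP xP /asboolP yP; apply/asboolP => K HK;
    rewrite rpred_div ?xP ?yP.
Qed.

HB.instance Definition _ := GRing.isDivringClosed.Build R[i] Qpi_pred
  Qpi_divring_closed.

Record Qpi := MkQpi { Qpi_val : R[i]; _ : Qpi_val \in Qpi_pred }.

HB.instance Definition _ := [isSub for Qpi_val].
HB.instance Definition _ := [Choice of Qpi by <:].
HB.instance Definition _ := [SubChoice_isSubIntegralDomain of Qpi by <:].
HB.instance Definition _ := [SubIntegralDomain_isSubField of Qpi by <:].

End Qpi.

Definition etau (R : realType) (x : R) : R[i] := cexp (0 +i* (2 * pi * x)).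

Section EtauTheory.
Variable R : realType.
Implicit Types x y : R.

Lemma etauE x : etau x = cos (2 * pi * x) +i* sin (2 * pi * x).
Proof.
by rewrite /etau /cexp expR0 !mul1r.
Qed.

Lemma etau0 : etau (0 : R) = 1.
Proof. by rewrite etauE mulr0 cos0 sin0. Qed.

Lemma etauD x y : etau (x + y) = etau x * etau y.
Proof. rewrite /etau -cexpD; congr cexp.
by apply/eqP; rewrite eq_complex /=; apply/andP; split; apply/eqP; ring. Qed.

Lemma etauX x n : etau x ^+ n = etau (n%:R * x).
Proof.
elim: n => [|n IH]; first by rewrite mul0r etau0.
by rewrite exprS IH -etauD -nat1r mulrDl mul1r.
Qed.

Lemma etau1 : etau (1 : R) = 1.
Proof. by rewrite etauE mulr1 mulr_natl cos2pi sin2pi. Qed.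

Lemma etau_nat n : etau (n%:R : R) = 1.
Proof. by rewrite -[n%:R]mulr1 -etauX etau1 expr1n. Qed.

Lemma etauN x : etau (- x) = (etau x)^-1.
Proof.
have xx1 : etau (- x) * etau x = 1 by rewrite -etauD addNr etau0.
have x0 : etau x != 0.
  by apply/eqP => x0; move/eqP: xx1; rewrite x0 mulr0 eq_sym oner_eq0.
by apply: (mulIf x0); rewrite xx1 mulVf.
Qed.

Lemma etau_neq0 x : etau x != 0.
Proof.
apply/eqP => x0; have := etauD x (- x).
by rewrite subrr etau0 x0 mul0r => /eqP; rewrite oner_eq0.
Qed.

Lemma etau_neq1 x : 0 < x < 1 -> etau x != 1.
Proof.
move=> /andP[x0 x1]; have pi0 := pi_gt0 R.
have s0 : 0 < sin (pi * x).
  by apply: sin_gt0_pi; rewrite mulr_gt0 //= -[ltRHS]mulr1 ltr_pM2l.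
apply/eqP; rewrite etauE => -[].
have -> : 2 * pi * x = pi * x + pi * x by ring.
rewrite cosD -!expr2 cos2sin2 => h _.
have : sin (pi * x) ^+ 2 = 0 by lra.
by move/eqP; rewrite sqrf_eq0 gt_eqF.
Qed.

Lemma etau_prim n : (0 < n)%N -> n.-primitive_root (etau (n%:R^-1 : R)).
Proof.
move=> n0; have n0' : 0 < n%:R :> R by rewrite ltr0n.
apply/andP; split => //; apply/forallP => i; apply/eqP.
rewrite unity_rootE etauX; case: (ltnP i.+1 n) => [lt_in|].
  rewrite (ltn_eqF lt_in); apply/negbTE/etau_neq1.
  by rewrite divr_gt0 ?ltr0n //= ltr_pdivrMr // mul1r ltr_nat.
move=> le_ni; have -> : i.+1 = n by apply/eqP; rewrite eqn_leq le_ni ltn_ord.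
by rewrite (divff (lt0r_neq0 n0')) etau1 !eqxx.
Qed.

End EtauTheory.

Section QpiElements.
Variable R : realType.

Lemma Qpi_cexp (a b : rat) :
  cexp (pi%:C * (ratr a +i* ratr b)) \in @Qpi_pred R.
Proof. by apply/asboolP => K; apply. Qed.

Lemma Qpi_etau (r : rat) : etau (ratr r : R) \in @Qpi_pred R.
Proof.
suff -> : etau (ratr r : R) = cexp (pi%:C * (ratr 0 +i* ratr (r + r))).
  exact: Qpi_cexp.
congr cexp; have -> : ratr (r + r) = ratr r + ratr r :> R by rewrite rmorphD.
rewrite raddf0.
by apply/eqP; rewrite eq_complex /=; apply/andP; split; apply/eqP; ring.
Qed.

Lemma Qpi_expR_pi (r : rat) : (expR (pi * ratr r))%:C \in @Qpi_pred R.
Proof.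
suff -> : (expR (pi * ratr r))%:C = cexp (pi%:C * (ratr r +i* ratr 0)) :> R[i].
  exact: Qpi_cexp.
rewrite -cexpR; congr cexp; rewrite raddf0.
by apply/eqP; rewrite eq_complex /=; apply/andP; split; apply/eqP; ring.
Qed.

Lemma Qpi_root_of_unity n (c : R[i]) :
  (0 < n)%N -> c ^+ n = 1 -> c \in @Qpi_pred R.
Proof.
move=> n0 cn1; have [i ->] := prim_rootP (etau_prim R n0) cn1.
by rewrite rpredX //; have := Qpi_etau n%:R^-1; rewrite fmorphV /= ratr_nat.
Qed.

Lemma Qpi_i : 0 +i* 1 \in @Qpi_pred R.
Proof.
apply: (@Qpi_root_of_unity 4) => //.
by apply/eqP; rewrite eq_complex /=; apply/andP; split; apply/eqP; ring.
Qed.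

Lemma prod_1Betau n : (0 < n)%N ->
  \prod_(1 <= i < n) (1 - etau (i%:R / n%:R : R)) = n%:R.
Proof.
move=> n0; have zp := etau_prim R n0.
have X10 : ('X - 1%:P : {poly R[i]}) != 0 by rewrite polyXsubC_eq0.
have /(mulfI X10) E : ('X - 1%:P) * \prod_(1 <= i < n)
    ('X - (etau (n%:R^-1 : R) ^+ i)%:P) = ('X - 1%:P) * \sum_(i < n) 'X^i.
  rewrite -subrX1 -(factor_Xn_sub_1 zp).
  by rewrite [in RHS]big_ltn // expr0.
have := congr1 (fun p => p.[1]) E.
rewrite horner_prod horner_sum => {}E.
transitivity (\prod_(1 <= i < n) ('X - (etau (n%:R^-1 : R) ^+ i)%:P).[1]).
  by apply: eq_bigr => i _; rewrite hornerXsubC etauX.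
rewrite E (eq_bigr (fun=> 1)) => [|i _].
  by rewrite sumr_const card_ord.
by rewrite hornerXn expr1n.
Qed.

Lemma etau_half : etau (2^-1 : R) = -1.
Proof.
rewrite etauE; have -> : 2 * pi * 2^-1 = pi :> R by field.
by rewrite cospi sinpi; apply/eqP; rewrite eq_complex /= oppr0 !eqxx.
Qed.

Lemma etau_quarter : etau (4^-1 : R) = 0 +i* 1.
Proof.
rewrite etauE; have -> : 2 * pi * 4^-1 = pi / 2 :> R by field.
by rewrite cos_pihalf sin_pihalf.
Qed.

(* Pair the factors i and n - i in the product above: up to a root of unity,
   (1 - e^(i tau (n-i)/n)) is (1 - e^(i tau i/n)). *)
Lemma Qpi_sqr_odd k :
  exists2 w, w \in @Qpi_pred R & w ^+ 2 = (k.*2.+1)%:R.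
Proof.
pose n := k.*2.+1.
have n0 : n%:R != 0 :> R by rewrite pnatr_eq0.
pose f i := 1 - etau (i%:R / n%:R : R).
pose h i := etau (4^-1 - i%:R / n%:R / 2 : R) * f i.
exists (\prod_(1 <= i < k.+1) h i).
  apply: rpred_prod => i _; rewrite rpredM // ?rpredB ?rpred1 //.
    have := Qpi_etau (4^-1 - i%:R / n%:R / 2).
    by rewrite rmorphB /= !(fmorph_div, fmorphV) /= !ratr_nat.
  have := Qpi_etau (i%:R / n%:R).
  by rewrite !(fmorph_div, fmorphV) /= !ratr_nat.
have rev : \prod_(k.+1 <= i < n) f i = \prod_(1 <= i < k.+1) f (n - i)%N.
  rewrite big_nat_rev /= -{1}[k.+1]add1n big_addn.
  have -> : (n - k = k.+1)%N by rewrite /n; lia.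
  by apply: eq_big_nat => i /andP[i1 ik]; congr f; rewrite /n; lia.
rewrite -(@prod_1Betau n) // -prodrXl.
rewrite [RHS](big_cat_nat (n := k.+1)) //=; last by rewrite /n; lia.
rewrite rev -big_split /=; apply: eq_big_nat => i /andP[i1 ik].
rewrite -/(f i) /h exprMn expr2 [f i ^+ 2]expr2 -etauD mulrA mulrC.
congr (_ * _); rewrite /f mulrBr mulr1 -etauD.
have -> : 4^-1 - i%:R / n%:R / 2 + (4^-1 - i%:R / n%:R / 2)
   = 2^-1 - i%:R / n%:R :> R by field.
have -> : 2^-1 - i%:R / n%:R + i%:R / n%:R = 2^-1 :> R by ring.
have -> : (n - i)%:R / n%:R = 1 + - (i%:R / n%:R) :> R.
  by rewrite natrB ?mulrBl ?divff // /n; lia.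
by rewrite !etauD etau_half etau1; ring.
Qed.

Lemma Qpi_sqr_nat n : exists2 w, w \in @Qpi_pred R & w ^+ 2 = n%:R.
Proof.
elim/ltn_ind: n => n IH; have [odd_n|even_n] := boolP (odd n).
  by rewrite -(odd_double_half n) odd_n add1n; exact: Qpi_sqr_odd.
have [->|n0] := posnP n; first by exists 0; rewrite ?rpred0 // expr0n.
have [w wQ w2] := IH n./2 ltac:(lia).
exists (w * ((1 + (0 +i* 1)) * etau (ratr (- 8^-1)))).
  by rewrite !rpredM ?rpredD ?rpred1 ?Qpi_i ?Qpi_etau.
rewrite !exprMn w2 etauX.
have -> : 2%:R * ratr (- 8^-1) = - 4^-1 :> R.
  by rewrite rmorphN fmorphV /= ratr_nat; field.
rewrite etauN etau_quarter.
have i2 : (0 +i* 1) ^+ 2 = -1 :> R[i].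
  by apply/eqP; rewrite eq_complex /=; apply/andP; split; apply/eqP; ring.
have i0 : 0 +i* 1 != 0 :> R[i] by rewrite -sqrf_eq0 i2 oppr_eq0 oner_eq0.
rewrite sqrrD i2 expr1n mul1r addrAC addrN add0r.
have -> : (0 +i* 1) *+ 2 = 2 * (0 +i* 1) :> R[i] by rewrite mulr_natl.
by rewrite ?mulfK // -natrM; congr _%:R; lia.
Qed.

Lemma Qpi_sqrt (r : rat) : (Num.sqrt (ratr r))%:C \in @Qpi_pred R.
Proof.
have [r0|r0] := ltP r 0.
  rewrite ler0_sqrtr ?rpred0 //.
  by rewrite -[0](rmorph0 (@ratr R)) ler_rat ltW.
have d0 : (0 : R) < `|denq r|%:R by rewrite ltr0n absz_gt0 denq_neq0.
have [w wQ w2] := Qpi_sqr_nat (`|numq r| * `|denq r|)%N.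
have -> : ratr r = (`|numq r| * `|denq r|)%:R / `|denq r|%:R ^+ 2 :> R.
  rewrite /ratr natrM !natr_absz.
  rewrite ger0_norm ?numq_ge0 // gtr0_norm ?denq_gt0 //.
  by rewrite natr_absz gtr0_norm ?denq_gt0 // in d0; field; rewrite gt_eqF.
rewrite sqrtrM ?ler0n // sqrtrV ?exprn_ge0 ?ler0n // sqrtr_sqr ger0_norm ?ler0n //.
rewrite rmorphM /= fmorphV /= rmorph_nat rpred_div ?rpred_nat //.
set s := Num.sqrt _; have s2 : s%:C ^+ 2 = w ^+ 2.
  by rewrite w2 -rmorphXn /= sqr_sqrtr ?ler0n // rmorph_nat.
by move/eqP: s2; rewrite eqf_sqr => /orP[] /eqP->; rewrite ?rpredN.
Qed.

End QpiElements.

(* [sqrtQ R r] is the square root of [r] (it is 0 if [r < 0]), and [exp_piQ R r]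
   is e^(pi r), as elements of Q^pi. *)
Definition sqrtQ (R : realType) (r : rat) : Qpi R := MkQpi (Qpi_sqrt R r).
Definition exp_piQ (R : realType) (r : rat) : Qpi R := MkQpi (Qpi_expR_pi R r).

Section RootsOfUnity.
Variable R : realType.

Definition root_of_unity : {pred R[i]} :=
  fun c => `[< exists2 n, (0 < n)%N & c ^+ n = 1 >].

Record TQ := MkTQ { TQ_val : R[i]; TQ_valP : TQ_val \in root_of_unity }.

HB.instance Definition _ := [isSub for TQ_val].
HB.instance Definition _ := [Choice of TQ by <:].

Lemma TQ_Qpi_subproof (c : TQ) : TQ_val c \in @Qpi_pred R.
Proof. by have /asboolP[n n0] := TQ_valP c; exact: Qpi_root_of_unity. Qed.

Definition TQ_Qpi (c : TQ) : Qpi R := MkQpi (TQ_Qpi_subproof c).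

Fact TQ1_subproof : 1 \in root_of_unity.
Proof. by apply/asboolP; exists 1%N. Qed.
Definition TQ1 : TQ := MkTQ TQ1_subproof.

Fact TQM_subproof (c d : TQ) : TQ_val c * TQ_val d \in root_of_unity.
Proof.
have /asboolP[m m0 cm] := TQ_valP c; have /asboolP[n n0 dn] := TQ_valP d.
apply/asboolP; exists (m * n)%N; first by rewrite muln_gt0 m0.
by rewrite exprMn exprM cm [in X in _ * X]mulnC exprM dn !expr1n mulr1.
Qed.
Definition TQM (c d : TQ) : TQ := MkTQ (TQM_subproof c d).

Fact TQV_subproof (c : TQ) : (TQ_val c)^-1 \in root_of_unity.
Proof.
have /asboolP[m m0 cm] := TQ_valP c.
by apply/asboolP; exists m => //; rewrite exprVn cm invr1.
Qed.
Definition TQV (c : TQ) : TQ := MkTQ (TQV_subproof c).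

Fact TQ_etau_subproof (r : rat) : etau (ratr r : R) \in root_of_unity.
Proof.
apply/asboolP; exists `|denq r|%N; first by rewrite absz_gt0 denq_neq0.
have d0 : (denq r)%:~R != 0 :> R by rewrite intr_eq0 denq_neq0.
have -> : etau (ratr r : R) ^+ `|denq r| = etau ((numq r)%:~R : R).
  by rewrite etauX natr_absz gtr0_norm ?denq_gt0 // /ratr mulrC divfK.
case: (intP (numq r)) => [|n|n]; first exact: etau0.
  exact: (etau_nat R n.+1).
by rewrite mulrNz etauN (etau_nat R n.+1) invr1.
Qed.
(* the root of unity e^(i tau r) *)
Definition TQ_etau (r : rat) : TQ := MkTQ (TQ_etau_subproof r).

End RootsOfUnity.

Section HeisenbergGroup.
Variable R : realType.

(* [Heis c x xi] is the element written c(x, xi) *)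
Record heis := Heis { heis_c : TQ R; heis_x : rat; heis_xi : rat }.

Definition heis_prod h := (heis_c h, heis_x h, heis_xi h).
Definition prod_heis (t : TQ R * rat * rat) := Heis t.1.1 t.1.2 t.2.
Fact heis_prodK : cancel heis_prod prod_heis. Proof. by case. Qed.

HB.instance Definition _ := Choice.copy heis (can_type heis_prodK).

Definition heis_one := Heis (TQ1 R) 0 0.
Definition heis_mul h k :=
  Heis (TQM (TQM (heis_c h) (heis_c k)) (TQ_etau R (heis_xi h * heis_x k)))
       (heis_x h + heis_x k) (heis_xi h + heis_xi k).
Definition heis_inv h :=
  Heis (TQM (TQV (heis_c h)) (TQ_etau R (heis_xi h * heis_x h)))
       (- heis_x h) (- heis_xi h).

Lemma heisP h k : TQ_val (heis_c h) = TQ_val (heis_c k) ->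
  heis_x h = heis_x k -> heis_xi h = heis_xi k -> h = k.
Proof.
by case: h k => [c x xi] [d y eta] /= /val_inj -> -> ->.
Qed.

Let etauDr (r s : rat) :
  etau (ratr (r + s) : R) = etau (ratr r) * etau (ratr s).
Proof. by rewrite -etauD; congr etau; rewrite rmorphD. Qed.

Let etauNr (r : rat) : etau (ratr (- r) : R) = (etau (ratr r))^-1.
Proof. by rewrite -etauN; congr etau; rewrite rmorphN. Qed.

Let etaur0 : etau (ratr 0 : R) = 1.
Proof. by rewrite -etau0; congr etau; rewrite rmorph0. Qed.

Let TQ_neq0 (c : TQ R) : TQ_val c != 0.
Proof.
have /asboolP[n n0 cn] := TQ_valP c; apply/eqP => c0.
by move/eqP: cn; rewrite c0 expr0n eqn0Ngt n0 /= eq_sym oner_eq0.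
Qed.

Fact heis_mulA : associative heis_mul.
Proof.
move=> [c x xi] [d y eta] [e z zeta]; apply: heisP; rewrite /= ?addrA //.
by rewrite mulrDr mulrDl !etauDr; ring.
Qed.

Fact heis_mul1 : left_id heis_one heis_mul.
Proof.
by move=> [c x xi]; apply: heisP; rewrite /= ?add0r // mul0r etaur0 mul1r mulr1.
Qed.

Fact heis_1mul : right_id heis_one heis_mul.
Proof.
by move=> [c x xi]; apply: heisP; rewrite /= ?addr0 // mulr0 etaur0 !mulr1.
Qed.

Fact heis_mulV : left_inverse heis_one heis_inv heis_mul.
Proof.
move=> [c x xi]; apply: heisP; rewrite /= ?addNr //.
by rewrite mulNr etauNr mulrAC mulfK ?etau_neq0 // mulVf.
Qed.

Fact heis_Vmul : right_inverse heis_one heis_inv heis_mul.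
Proof.
move=> [c x xi]; apply: heisP; rewrite /= ?addrN //.
by rewrite mulrN etauNr mulrA mulfK ?etau_neq0 // mulfV.
Qed.

HB.instance Definition _ := isGroup.Build heis
  heis_mulA heis_mul1 heis_1mul heis_mulV heis_Vmul.

Definition heis_pos (x : rat) : heis := Heis (TQ1 R) x 0.
Definition heis_freq (xi : rat) : heis := Heis (TQ1 R) 0 xi.

End HeisenbergGroup.

(* Linearity of the products in the second argument follows from
   commutativity. *)
HB.mixin Record isHeisenbergTwain (R : realType) A of GRing.Lmodule (Qpi R) A := {
  star : A -> A -> A;
  dot : A -> A -> A;
  hact : heis R -> A -> A;
  star_linearl : forall b, linear (star^~ b);
  starA : associative star;
  starC : commutative star;
  dot_linearl : forall b, linear (dot^~ b);
  dotA : associative dot;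
  dotC : commutative dot;
  hact_linear : forall h, linear (hact h);
  hact1 : forall a, hact 1%g a = a;
  hactM : forall h k a, hact (h * k)%g a = hact h (hact k a);
  hact_scalar : forall c a, hact (Heis c 0 0) a = TQ_Qpi c *: a;
  hact_pos_star : forall x a b,
    hact (heis_pos R x) (star a b) = star (hact (heis_pos R x) a) b;
  hact_freq_star : forall xi a b,
    hact (heis_freq R xi) (star a b) =
    star (hact (heis_freq R xi) a) (hact (heis_freq R xi) b);
  hact_freq_dot : forall xi a b,
    hact (heis_freq R xi) (dot a b) = dot (hact (heis_freq R xi) a) b;
  hact_pos_dot : forall x a b,
    hact (heis_pos R x) (dot a b) =
    dot (hact (heis_pos R x) a) (hact (heis_pos R x) b)
}.

#[short(type="twainType")]
HB.structure Definition HeisenbergTwain (R : realType) :=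
  { A of GRing.Lmodule (Qpi R) A & isHeisenbergTwain R A }.

Definition twain_morphism (R : realType) (A B : twainType R) (f : A -> B) :=
  [/\ linear f, {morph f : a b / star a b}, {morph f : a b / dot a b}
    & forall h, {morph f : a / hact h a}].

Definition is_free_twain (R : realType) (T : twainType R) (u : T) :=
  forall (A : twainType R) (a : A),
    exists! f : T -> A, twain_morphism f /\ f u = a.

HB.mixin Record isTwainIdeal (R : realType) (A : twainType R) (I : {pred A}) := {
  ideal_star : forall a b, b \in I -> star a b \in I;
  ideal_dot : forall a b, b \in I -> dot a b \in I;
  ideal_hact : forall h a, a \in I -> hact h a \in I
}.

#[short(type="twainIdeal")]
HB.structure Definition TwainIdeal (R : realType) (A : twainType R) :=
  { I of GRing.AddClosed A I & GRing.isScaleClosed (Qpi R) A I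
       & isTwainIdeal R A I }.

Section GeneratedIdeal.
Variables (R : realType) (A : twainType R) (S : set A).

Definition twain_gen : {pred A} := fun a =>
  `[< forall I : twainIdeal A, (forall s, S s -> s \in I) -> a \in I >].

Lemma twain_gen_sub s : S s -> s \in twain_gen.
Proof. by move=> Ss; apply/asboolP => I; apply. Qed.

Fact twain_gen_add : addr_closed twain_gen.
Proof.
split=> [|a b /asboolP aP /asboolP bP]; apply/asboolP => I SI.
  exact: rpred0.
by rewrite rpredD ?aP ?bP.
Qed.

Fact twain_gen_scale k : {in twain_gen, forall a, k *: a \in twain_gen}.
Proof.
by move=> a /asboolP aP; apply/asboolP => I SI; apply: rpredZ; exact: aP.
Qed.

Fact twain_gen_star a b : b \in twain_gen -> star a b \in twain_gen.
Proof.
by move=> /asboolP bP; apply/asboolP => I SI; apply: ideal_star; exact: bP.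
Qed.

Fact twain_gen_dot a b : b \in twain_gen -> dot a b \in twain_gen.
Proof.
by move=> /asboolP bP; apply/asboolP => I SI; apply: ideal_dot; exact: bP.
Qed.

Fact twain_gen_hact h a : a \in twain_gen -> hact h a \in twain_gen.
Proof.
by move=> /asboolP aP; apply/asboolP => I SI; apply: ideal_hact; exact: aP.
Qed.

HB.instance Definition _ := GRing.isAddClosed.Build A twain_gen twain_gen_add.
HB.instance Definition _ := GRing.isScaleClosed.Build (Qpi R) A twain_gen
  twain_gen_scale.
HB.instance Definition _ := isTwainIdeal.Build R A twain_gen
  twain_gen_star twain_gen_dot twain_gen_hact.

End GeneratedIdeal.

Section TwainQuotient.
Variables (R : realType) (A : twainType R) (I : twainIdeal A).

Definition ideal_pred : {pred A} := I.

Fact ideal_zmod_closed : zmod_closed ideal_pred.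
Proof.
split=> [|a b aI bI]; first exact: rpred0.
by rewrite -scaleN1r; apply: rpredD => //; exact: rpredZ.
Qed.
HB.instance Definition _ :=
  GRing.isZmodClosed.Build A ideal_pred ideal_zmod_closed.

Definition twain_quot := {ideal_quot ideal_pred}.
HB.instance Definition _ := GRing.Zmodule.on twain_quot.
HB.instance Definition _ := EqQuotient.on twain_quot.

Definition twain_proj (a : A) : twain_quot := (\pi_twain_quot a)%qT.

Lemma twain_projP a b : twain_proj a = twain_proj b <-> a - b \in I.
Proof.
have -> : (a - b \in I) = (twain_proj a == twain_proj b).
  exact: (Quotient.idealrBE ideal_pred).
by split=> [/eqP|/eqP].
Qed.

Let reprP (q : twain_quot) : twain_proj (repr q) = q.
Proof. exact: reprK. Qed.

Let repr_proj a : repr (twain_proj a) - a \in I.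
Proof. exact/twain_projP/reprP. Qed.

Lemma twain_projD a b : twain_proj (a + b) = twain_proj a + twain_proj b.
Proof. exact: (Quotient.pi_add ideal_pred). Qed.

Definition quot_scale k (q : twain_quot) := twain_proj (k *: repr q).
Definition quot_star (p q : twain_quot) := twain_proj (star (repr p) (repr q)).
Definition quot_dot (p q : twain_quot) := twain_proj (dot (repr p) (repr q)).
Definition quot_hact h (q : twain_quot) := twain_proj (hact h (repr q)).

Let linearB (V W : lmodType (Qpi R)) (f : V -> W) a b :
  linear f -> f (a - b) = f a - f b.
Proof. by move=> lf; rewrite addrC -scaleN1r lf scaleN1r addrC. Qed.

Lemma twain_projZ k a : twain_proj (k *: a) = quot_scale k (twain_proj a).
Proof.
by apply/twain_projP; rewrite -scalerBr rpredZ // -opprB -scaleN1r rpredZ.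
Qed.

Let cong2 (op : A -> A -> A) (a b c d : A) :
    (forall b, linear (op^~ b)) -> commutative op ->
    (forall a b, b \in I -> op a b \in I) ->
  a - c \in I -> b - d \in I -> op a b - op c d \in I.
Proof.
move=> opl opC opI ac bd.
have -> : op a b - op c d = op b (a - c) + op c (b - d).
  have opBr x y z : op x (y - z) = op x y - op x z.
    by rewrite !(opC x) (linearB _ _ (opl x)).
  by rewrite !opBr [op b a]opC [op b c]opC addrA subrK.
by rewrite rpredD ?opI.
Qed.

Lemma twain_proj_star a b :
  twain_proj (star a b) = quot_star (twain_proj a) (twain_proj b).
Proof.
apply/esym/twain_projP; apply: cong2 => //; first exact: star_linearl.
- exact: starC.
- exact: ideal_star.
Qed.

Lemma twain_proj_dot a b :
  twain_proj (dot a b) = quot_dot (twain_proj a) (twain_proj b).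
Proof.
apply/esym/twain_projP; apply: cong2 => //; first exact: dot_linearl.
- exact: dotC.
- exact: ideal_dot.
Qed.

Lemma twain_proj_hact h a :
  twain_proj (hact h a) = quot_hact h (twain_proj a).
Proof.
apply/esym/twain_projP; rewrite -(linearB _ _ (hact_linear h)).
exact: ideal_hact.
Qed.

Let pushE := (twain_proj_star, twain_proj_dot, twain_proj_hact,
              twain_projD, twain_projZ).

Fact quot_scaleA k l q : quot_scale k (quot_scale l q) = quot_scale (k * l) q.
Proof. by rewrite -(reprP q) -!twain_projZ scalerA. Qed.
Fact quot_scale1 : left_id 1 quot_scale.
Proof. by move=> q; rewrite -(reprP q) -!twain_projZ scale1r. Qed.
Fact quot_scaleDr : right_distributive quot_scale +%R.
Proof.
move=> k p q; rewrite -(reprP p) -(reprP q).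
by rewrite -!(twain_projD, twain_projZ) scalerDr.
Qed.
Fact quot_scaleDl q : {morph quot_scale^~ q : k l / k + l}.
Proof.
by move=> k l; rewrite -(reprP q) -!(twain_projD, twain_projZ) scalerDl.
Qed.

HB.instance Definition _ := GRing.Zmodule_isLmodule.Build (Qpi R) twain_quot
  quot_scaleA quot_scale1 quot_scaleDr quot_scaleDl.

Let projZ k a : twain_proj (k *: a) = k *: twain_proj a.
Proof. exact: twain_projZ. Qed.

Let pullE := (twain_proj_star, twain_proj_dot, twain_proj_hact,
              twain_projD, projZ).

Fact quot_star_linearl q : linear (quot_star^~ q).
Proof.
move=> k a b; rewrite -(reprP q) -(reprP a) -(reprP b).
by rewrite -!pullE star_linearl.
Qed.
Fact quot_starA : associative quot_star.
Proof.
move=> a b c; rewrite -(reprP a) -(reprP b) -(reprP c).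
by rewrite -!pullE starA.
Qed.
Fact quot_starC : commutative quot_star.
Proof.
by move=> a b; rewrite -(reprP a) -(reprP b) -!pullE starC.
Qed.
Fact quot_dot_linearl q : linear (quot_dot^~ q).
Proof.
move=> k a b; rewrite -(reprP q) -(reprP a) -(reprP b).
by rewrite -!pullE dot_linearl.
Qed.
Fact quot_dotA : associative quot_dot.
Proof.
move=> a b c; rewrite -(reprP a) -(reprP b) -(reprP c).
by rewrite -!pullE dotA.
Qed.
Fact quot_dotC : commutative quot_dot.
Proof.
by move=> a b; rewrite -(reprP a) -(reprP b) -!pullE dotC.
Qed.
Fact quot_hact_linear h : linear (quot_hact h).
Proof.
move=> k a b; rewrite -(reprP a) -(reprP b).
by rewrite -!pullE hact_linear.
Qed.
Fact quot_hact1 q : quot_hact 1%g q = q.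
Proof. by rewrite -(reprP q) -!pullE hact1. Qed.
Fact quot_hactM h k q : quot_hact (h * k)%g q = quot_hact h (quot_hact k q).
Proof. by rewrite -(reprP q) -!pullE hactM. Qed.
Fact quot_hact_scalar c q : quot_hact (Heis c 0 0) q = TQ_Qpi c *: q.
Proof. by rewrite -(reprP q) -!pullE hact_scalar. Qed.
Fact quot_hact_pos_star x a b : quot_hact (heis_pos R x) (quot_star a b) =
  quot_star (quot_hact (heis_pos R x) a) b.
Proof. by rewrite -(reprP a) -(reprP b) -!pullE hact_pos_star. Qed.
Fact quot_hact_freq_star xi a b :
  quot_hact (heis_freq R xi) (quot_star a b) =
  quot_star (quot_hact (heis_freq R xi) a) (quot_hact (heis_freq R xi) b).
Proof. by rewrite -(reprP a) -(reprP b) -!pullE hact_freq_star. Qed.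
Fact quot_hact_freq_dot xi a b : quot_hact (heis_freq R xi) (quot_dot a b) =
  quot_dot (quot_hact (heis_freq R xi) a) b.
Proof. by rewrite -(reprP a) -(reprP b) -!pullE hact_freq_dot. Qed.
Fact quot_hact_pos_dot x a b :
  quot_hact (heis_pos R x) (quot_dot a b) =
  quot_dot (quot_hact (heis_pos R x) a) (quot_hact (heis_pos R x) b).
Proof. by rewrite -(reprP a) -(reprP b) -!pullE hact_pos_dot. Qed.

HB.instance Definition _ := isHeisenbergTwain.Build R twain_quot
  quot_star_linearl quot_starA quot_starC
  quot_dot_linearl quot_dotA quot_dotC
  quot_hact_linear quot_hact1 quot_hactM quot_hact_scalar
  quot_hact_pos_star quot_hact_freq_star quot_hact_freq_dot quot_hact_pos_dot.

Lemma twain_proj_morphism : twain_morphism twain_proj.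
Proof.
split; first by move=> k a b; rewrite twain_projD projZ.
- exact: twain_proj_star.
- exact: twain_proj_dot.
- by move=> h a; exact: twain_proj_hact.
Qed.

End TwainQuotient.

Section FreeTwain.
Variable R : realType.

Inductive twain_term :=
| TGen | TZero
| TAdd of twain_term & twain_term
| TScale of Qpi R & twain_term
| TStar of twain_term & twain_term
| TDot of twain_term & twain_term
| TAct of heis R & twain_term.

HB.instance Definition _ := gen_eqMixin twain_term.
HB.instance Definition _ := gen_choiceMixin twain_term.

Fixpoint teval (A : twainType R) (a : A) (t : twain_term) : A :=
  match t with
  | TGen => a
  | TZero => 0
  | TAdd s t => teval a s + teval a t
  | TScale k t => k *: teval a t
  | TStar s t => star (teval a s) (teval a t)
  | TDot s t => dot (teval a s) (teval a t)
  | TAct h t => hact h (teval a t)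
  end.

(* Terms are identified when they agree in all Heisenberg twain algebras. *)
Definition teq : rel twain_term := fun s t =>
  `[< forall (A : twainType R) (a : A), teval a s = teval a t >].

Fact teq_refl : reflexive teq. Proof. by move=> t; apply/asboolP. Qed.
Fact teq_sym : symmetric teq.
Proof.
by move=> s t; apply/idP/idP => /asboolP st; apply/asboolP => A a; rewrite st.
Qed.
Fact teq_trans : transitive teq.
Proof.
move=> t s r /asboolP st /asboolP tr.
by apply/asboolP => A a; rewrite st tr.
Qed.
Canonical teq_equiv := EquivRel teq teq_refl teq_sym teq_trans.

Definition free_twain := {eq_quot teq}%qT.
HB.instance Definition _ := Choice.on free_twain.

Definition free_proj (t : twain_term) : free_twain := (\pi_free_twain t)%qT.

Lemma free_projP s t : free_proj s = free_proj t <->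
  forall (A : twainType R) (a : A), teval a s = teval a t.
Proof.
split=> [/eqmodP|st]; first by move/asboolP.
by apply/eqmodP/asboolP.
Qed.

Let term_of (q : free_twain) : twain_term := repr q.
Let term_ofK q : free_proj (term_of q) = q.
Proof. exact: reprK. Qed.
Let evalK (A : twainType R) (a : A) t : teval a (term_of (free_proj t)) = teval a t.
Proof. exact: (free_projP _ _).1 (term_ofK _) A a. Qed.

Definition free_zero := free_proj TZero.
Definition free_add p q := free_proj (TAdd (term_of p) (term_of q)).
Definition free_scale k p := free_proj (TScale k (term_of p)).
Definition free_opp p := free_scale (-1) p.
Definition free_star p q := free_proj (TStar (term_of p) (term_of q)).
Definition free_dot p q := free_proj (TDot (term_of p) (term_of q)).
Definition free_hact h p := free_proj (TAct h (term_of p)).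

Let inj_eval p q :
  (forall (A : twainType R) (a : A), teval a (term_of p) = teval a (term_of q)) ->
  p = q.
Proof. by move=> pq; rewrite -(term_ofK p) -(term_ofK q); apply/free_projP. Qed.

Fact free_addA : associative free_add.
Proof. by move=> p q r; apply: inj_eval => A a; rewrite !evalK /= !evalK /= addrA. Qed.
Fact free_addC : commutative free_add.
Proof. by move=> p q; apply: inj_eval => A a; rewrite !evalK /= addrC. Qed.
Fact free_add0 : left_id free_zero free_add.
Proof. by move=> p; apply: inj_eval => A a; rewrite !evalK /= !evalK add0r. Qed.
Fact free_addN : left_inverse free_zero free_opp free_add.
Proof.
move=> p; apply: inj_eval => A a.
by rewrite !evalK /= !evalK /= scaleN1r addNr.
Qed.
HB.instance Definition _ :=
  GRing.isZmodule.Build free_twain free_addA free_addC free_add0 free_addN.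

Let evalD (A : twainType R) (a : A) (p q : free_twain) :
  teval a (term_of (p + q)) = teval a (term_of p) + teval a (term_of q).
Proof. exact: evalK. Qed.

Fact free_scaleA k l q : free_scale k (free_scale l q) = free_scale (k * l) q.
Proof. by apply: inj_eval => A a; rewrite !evalK /= !evalK /= scalerA. Qed.
Fact free_scale1 : left_id 1 free_scale.
Proof. by move=> p; apply: inj_eval => A a; rewrite !evalK /= scale1r. Qed.
Fact free_scaleDr : right_distributive free_scale +%R.
Proof.
move=> k p q; apply: inj_eval => A a.
by rewrite evalK /= !evalD !evalK scalerDr.
Qed.
Fact free_scaleDl q : {morph free_scale^~ q : k l / k + l}.
Proof.
move=> k l; apply: inj_eval => A a.
by rewrite evalD !evalK /= scalerDl.
Qed.
HB.instance Definition _ := GRing.Zmodule_isLmodule.Build (Qpi R) free_twain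
  free_scaleA free_scale1 free_scaleDr free_scaleDl.

Let evalZ (A : twainType R) (a : A) k (p : free_twain) :
  teval a (term_of (k *: p)) = k *: teval a (term_of p).
Proof. exact: evalK. Qed.

Fact free_star_linearl q : linear (free_star^~ q).
Proof.
move=> k p r; apply: inj_eval => A a.
by rewrite !(evalD, evalZ, evalK) /= ?(evalD, evalZ, evalK) /=; rewrite star_linearl.
Qed.
Fact free_starA : associative free_star.
Proof.
move=> p q r; apply: inj_eval => A a.
by rewrite !(evalD, evalZ, evalK) /= ?(evalD, evalZ, evalK) /=; rewrite starA.
Qed.
Fact free_starC : commutative free_star.
Proof. by move=> p q; apply: inj_eval => A a; rewrite !evalK /= starC. Qed.
Fact free_dot_linearl q : linear (free_dot^~ q).
Proof.
move=> k p r; apply: inj_eval => A a.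
by rewrite !(evalD, evalZ, evalK) /= ?(evalD, evalZ, evalK) /=; rewrite dot_linearl.
Qed.
Fact free_dotA : associative free_dot.
Proof.
move=> p q r; apply: inj_eval => A a.
by rewrite !(evalD, evalZ, evalK) /= ?(evalD, evalZ, evalK) /=; rewrite dotA.
Qed.
Fact free_dotC : commutative free_dot.
Proof. by move=> p q; apply: inj_eval => A a; rewrite !evalK /= dotC. Qed.
Fact free_hact_linear h : linear (free_hact h).
Proof.
move=> k p q; apply: inj_eval => A a.
by rewrite !(evalD, evalZ, evalK) /= ?(evalD, evalZ, evalK) /=; rewrite hact_linear.
Qed.
Fact free_hact1 q : free_hact 1%g q = q.
Proof. by apply: inj_eval => A a; rewrite !evalK /= hact1. Qed.
Fact free_hactM h k q : free_hact (h * k)%g q = free_hact h (free_hact k q).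
Proof. by apply: inj_eval => A a; rewrite !(evalD, evalZ, evalK) /= ?(evalD, evalZ, evalK) /=; rewrite hactM. Qed.
Fact free_hact_scalar c q : free_hact (Heis c 0 0) q = TQ_Qpi c *: q.
Proof. by apply: inj_eval => A a; rewrite !(evalD, evalZ, evalK) /= ?(evalD, evalZ, evalK) /=; rewrite hact_scalar. Qed.
Fact free_hact_pos_star x p q :
  free_hact (heis_pos R x) (free_star p q) = free_star (free_hact (heis_pos R x) p) q.
Proof.
by apply: inj_eval => A a; rewrite !(evalD, evalZ, evalK) /= ?(evalD, evalZ, evalK) /=; rewrite hact_pos_star.
Qed.
Fact free_hact_freq_star xi p q : free_hact (heis_freq R xi) (free_star p q) =
  free_star (free_hact (heis_freq R xi) p) (free_hact (heis_freq R xi) q).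
Proof.
by apply: inj_eval => A a; rewrite !(evalD, evalZ, evalK) /= ?(evalD, evalZ, evalK) /=; rewrite hact_freq_star.
Qed.
Fact free_hact_freq_dot xi p q :
  free_hact (heis_freq R xi) (free_dot p q) = free_dot (free_hact (heis_freq R xi) p) q.
Proof.
by apply: inj_eval => A a; rewrite !(evalD, evalZ, evalK) /= ?(evalD, evalZ, evalK) /=; rewrite hact_freq_dot.
Qed.
Fact free_hact_pos_dot x p q : free_hact (heis_pos R x) (free_dot p q) =
  free_dot (free_hact (heis_pos R x) p) (free_hact (heis_pos R x) q).
Proof.
by apply: inj_eval => A a; rewrite !(evalD, evalZ, evalK) /= ?(evalD, evalZ, evalK) /=; rewrite hact_pos_dot.
Qed.

HB.instance Definition _ := isHeisenbergTwain.Build R free_twain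
  free_star_linearl free_starA free_starC free_dot_linearl free_dotA free_dotC
  free_hact_linear free_hact1 free_hactM free_hact_scalar
  free_hact_pos_star free_hact_freq_star free_hact_freq_dot free_hact_pos_dot.

Lemma free_twainP : is_free_twain (free_proj TGen : free_twain).
Proof.
move=> A a; exists (fun q => teval a (term_of q)); split.
  split; last by rewrite evalK.
  split=> [k p q|p q|p q|h p]; first by rewrite evalD evalZ.
  - exact: evalK.
  - exact: evalK.
  - exact: evalK.
move=> f [[fl fs fd fh] fg]; apply/funext => q.
rewrite -[in RHS](term_ofK q); elim: (term_of q) => /=.
- by rewrite fg.
- have f0E : f 0 = f 0 + f 0.
    by have := fl 1 0 0; rewrite scaler0 addr0 scale1r.
  by apply: (addrI (f 0)); rewrite -[X in _ = _ + X]/(f 0) -f0E addr0.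
- move=> s -> t ->; rewrite -[f (free_proj s)]scale1r -fl scale1r; congr f.
  by apply/esym/free_projP => B b /=; rewrite !evalK.
- move=> k t ->; have f0E : f 0 = 0.
    apply: (addrI (f 0)); have := fl 1 0 0.
    by rewrite scaler0 addr0 scale1r => <-; rewrite addr0.
  rewrite -[LHS]addr0 -f0E -fl addr0; congr f.
  by apply/esym/free_projP => B b /=; rewrite !evalK.
- move=> s -> t ->; rewrite -fs; congr f.
  by apply/esym/free_projP => B b /=; rewrite !evalK.
- move=> s -> t ->; rewrite -fd; congr f.
  by apply/esym/free_projP => B b /=; rewrite !evalK.
- move=> h t ->; rewrite -fh; congr f.
  by apply/esym/free_projP => B b /=; rewrite !evalK.
Qed.

End FreeTwain.

Section Relations.
Variables (R : realType) (T : twainType R) (u : T).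
Implicit Types rho mu alpha : rat.

(* n-fold powers for a product without unit, meaningful for n > 0 *)
Definition star_pow (a : T) n := iterop n star a 0.
Definition dot_pow (a : T) n := iterop n dot a 0.

Definition u_ rho : T :=
  let n := `|numq rho|%N in let m := `|denq rho|%N in
  sqrtQ R (m%:R * n%:R ^+ m.-1) *: star_pow (dot_pow u n) m.

Definition boxplus rho rho' : rat := rho * rho' / (rho + rho').

Definition rel_freq_star : set T := [set r |
  exists alpha alpha' rho rho', [/\ 0 < rho, 0 < rho' &
    r = star (hact (heis_freq R alpha) (u_ rho))
             (hact (heis_freq R alpha') (u_ rho'))
        - (exp_piQ R (- ((alpha - alpha') ^+ 2 / (rho + rho')))
             / sqrtQ R (rho + rho'))
          *: hact (heis_freq R ((alpha * rho' + alpha' * rho) / (rho + rho')))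
                  (u_ (boxplus rho rho'))]]%classic.

Definition rel_pos_dot : set T := [set r |
  exists mu mu' rho rho', [/\ 0 < rho, 0 < rho' &
    r = dot (hact (heis_pos R mu) (u_ rho)) (hact (heis_pos R mu') (u_ rho'))
        - exp_piQ R (- (boxplus rho rho' * (mu - mu') ^+ 2))
          *: hact (heis_pos R ((mu * rho + mu' * rho') / (rho + rho')))
                  (u_ (rho + rho'))]]%classic.

Definition rel_star_dot : set T := [set r |
  exists n m : nat, [/\ (0 < n)%N, (0 < m)%N &
    r = dot_pow (star_pow u m) n
        - sqrtQ R (n%:R ^+ m.-1 / m%:R ^+ n.-1)
          *: star_pow (dot_pow u n) m]]%classic.

Definition gaussian_relations : set T :=
  (rel_freq_star `|` rel_pos_dot `|` rel_star_dot)%classic.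

End Relations.

Section GaussianClosure.
Variable R : realType.
Implicit Types (s t : R -> R[i]) (alpha mu rho : rat) (x y : R).

Definition e_ alpha : R -> R[i] := fun x => etau (ratr alpha * x).

Definition g_ mu rho : R -> R[i] :=
  fun x => (expR (- (pi * ratr rho * (x - ratr mu) ^+ 2)))%:C.

Definition unit_gaussian : R -> R[i] := fun x => (expR (- (pi * x ^+ 2)))%:C.

Definition gaussian_closure : set (R -> R[i]) := [set s |
  exists n (c : 'I_n -> Qpi R) (alpha mu rho : 'I_n -> rat),
    (forall i, 0 < rho i) /\
    s = fun x =>
      \sum_(i < n) Qpi_val (c i) * (e_ (alpha i) x * g_ (mu i) (rho i) x)
  ]%classic.

Definition convolution s t : R -> R[i] := fun x =>
  (\int[lebesgue_measure]_y complex.Re (s y * t (x - y)))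
  +i* (\int[lebesgue_measure]_y complex.Im (s y * t (x - y))).

(* [B], identified through [ev] with a set of functions on the real line, is
   the Gaussian closure with its standard operations. The action of scalars
   c(0, 0) is prescribed by the axioms of Heisenberg twain algebras. *)
Record is_gaussian_closure (B : twainType R) (ev : B -> R -> R[i]) : Prop := {
  ev_inj : injective ev;
  ev_range : range ev = gaussian_closure;
  ev_linear : forall k a b x, ev (k *: a + b) x = Qpi_val k * ev a x + ev b x;
  ev_star : forall a b, ev (star a b) = convolution (ev a) (ev b);
  ev_dot : forall a b x, ev (dot a b) x = ev a x * ev b x;
  ev_pos : forall mu a x, ev (hact (heis_pos R mu) a) x = ev a (x - ratr mu);
  ev_freq : forall alpha a x,
    ev (hact (heis_freq R alpha) a) x = etau (ratr alpha * x) * ev a x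
}.

End GaussianClosure.

(* Main.v *)
(** The formal Gaussians [f_(rho, w) = exp (pi (2 w x - rho x^2))], with
    [rho > 0] rational and [w] in Q(i), are linearly independent, and
    completing the square shows that both products and the Heisenberg action
    send them to multiples of formal Gaussians by elements of Q^pi. So the
    Gaussian closure is the free Q^pi-module on the pairs [(rho, w)], with
    explicit structure constants. The unit Gaussian satisfies the relations,
    whence a morphism [phi] from the presented algebra. Conversely the
    relations imply that [f_(rho, w) |-> c * (alpha . mu . u_rho)], with
    [w = rho mu + i alpha] and [c = exp (pi rho mu^2)], is a morphism [psi] on
    the free module; [psi \o phi] is the identity since the presented algebra
    has at most one endomorphism fixing its generator, and [phi \o psi] fixes
    each [f_(rho, w)]. *)
Require Import Defs.
From HB Require Import structures.
From mathcomp Require Import all_boot all_order all_algebra.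
From mathcomp Require Import all_classical all_reals all_analysis.
From mathcomp Require Import measurable_realfun complex.
From mathcomp Require Import freeg.
From mathcomp Require Import ring lra.

Set Implicit Arguments.
Unset Strict Implicit.
Unset Printing Implicit Defensive.

Import Order.TTheory GRing.Theory Num.Theory.
Import numFieldNormedType.Exports.

Local Open Scope classical_set_scope.
Local Open Scope ring_scope.
Local Open Scope complex_scope.

(** * Gaussian integrals with a complex parameter *)

(** No axiom of a twain algebra is verified by analysis. The structure lives on a free module, where
    associativity and the Heisenberg axioms are rational identities between keys and constants;
    integrals occur only when evaluation is compared with convolution on two basis elements. Storing
    one linear coefficient [w] in Q(i), instead of a centre and a frequency, removes the constant
    term of the exponent: the pointwise product just adds keys, and all other constants are some
    [e^(pi z)] with [z] in Q(i), up to the inverse square root of a rational, so that Q^pi is large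
    enough. The one genuine integral is that of [exp (pi (2 (a + ib) y - s y^2))]. At [b = 0] it is
    a normal density. For general [b] no contour is moved: differentiation in [b] and integration by
    parts give a linear differential equation, and the value at [b = 0] fixes its solution. For
    linear independence, growth does not separate Gaussians of equal modulus. Their frequencies are
    rational, so sampling along a suitable arithmetic progression freezes them and leaves a relation
    between characters at an arbitrary point. *)

(* [pi] is transparent, and [ring] and [field] unfold it: it is generalized
   before they are called. *)
Section RealGaussian.
Variable R : realType.
Implicit Types s a b y : R.
Local Notation mu := (@lebesgue_measure R).

(** Without a constant term, products and quotients of such functions keep this form. [s] is
    unrestricted: the pure exponentials [s = 0] occur as quotients in the linear independence
    argument. *)
Definition gexp s a y : R := expR (pi * (2 * a * y - s * y ^+ 2)).

Lemma gexp_gt0 s a y : 0 < gexp s a y.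
Proof. exact: expR_gt0. Qed.

Global Instance is_derive_gexp s a y :
  is_derive y 1 (gexp s a) (2 * pi * (a - s * y) * gexp s a y).
Proof.
have d : is_derive y (1 : R) (pi *: ((2 * a) *: id - s *: (id * id)))
    (2 * pi * (a - s * y)).
  by apply: is_derive_eq; rewrite /GRing.scale/=; ring.
rewrite [gexp s a](_ : _ = expR \o (pi *: ((2 * a) *: id - s *: (id * id)))).
  by apply: is_derive_eq; rewrite mulrC.
by apply/funext => x.
Qed.

Lemma continuous_gexp s a : continuous (gexp s a).
Proof.
by move=> y; apply/differentiable_continuous/derivable1_diffP; exact: ex_derive.
Qed.

Lemma measurable_gexp s a : measurable_fun setT (gexp s a).
Proof. apply: continuous_measurable_fun; exact: continuous_gexp. Qed.

(** Completing the square gives mean [a / s] and variance [1 / (2 pi s)]; integrability and the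
    integral of [gexp] then come from the normal law. *)
Lemma gexp_normal_pdf s a y : 0 < s ->
  gexp s a y = (Num.sqrt s)^-1 * expR (pi * (a ^+ 2 / s)) *
    normal_pdf (a / s) (Num.sqrt (2 * pi * s)^-1) y.
Proof.
move=> s0; have pi0 := pi_gt0 R.
have ps0 : 0 < (2 * pi * s)^-1 by rewrite invr_gt0 !mulr_gt0.
rewrite normal_pdfE ?sqrtr_eq0 -?ltNge //.
rewrite /normal_peak /normal_fun sqr_sqrtr ?ltW //.
have -> : (2 * pi * s)^-1 * pi *+ 2 = s^-1.
  by move: (pi : R) pi0 => p p0; field; rewrite !gt_eqF.
rewrite sqrtrV ?ltW // invrK mulrACA mulVf ?mul1r ?gt_eqF ?sqrtr_gt0 //.
rewrite /gexp -expRD; congr expR; move: (pi : R) pi0 => p p0 {ps0}.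
by field; rewrite !gt_eqF.
Qed.

Lemma integrable_gexp s a : 0 < s -> mu.-integrable setT (EFin \o gexp s a).
Proof.
move=> s0; pose n := normal_pdf (a / s) (Num.sqrt (2 * pi * s)^-1).
have : mu.-integrable setT
    (fun y => ((Num.sqrt s)^-1 * expR (pi * (a ^+ 2 / s)))%:E * (n y)%:E)%E.
  by apply: integrableZl => //; exact: integrable_normal_pdf.
by apply: eq_integrable => // y _; rewrite /= gexp_normal_pdf // EFinM.
Qed.

Lemma Rintegral_gexp s a : 0 < s ->
  (\int[mu]_y gexp s a y = (Num.sqrt s)^-1 * expR (pi * (a ^+ 2 / s)))%R.
Proof.
move=> s0; under eq_Rintegral do rewrite gexp_normal_pdf //.
rewrite RintegralZl //; last exact: integrable_normal_pdf.
by rewrite /Rintegral integral_normal_pdf mulr1.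
Qed.

(** This is [|t| <= e^t + e^(-t)] at [t = 2 pi y], since the factors [e^t] and [e^(-t)] shift [a] by
    1 and -1. A factor [|y|] is thus absorbed into Gaussians, which serves for integrability, for
    decay, and as a bound for differentiation under the integral. *)
Lemma mul_gexp_le s a y :
  2 * pi * (`|y| * gexp s a y) <= gexp s (a + 1) y + gexp s (a - 1) y.
Proof.
have pi0 := pi_gt0 R.
have h (t : R) : `|t| <= expR t + expR (- t).
  rewrite ler_norml; have := expR_ge1Dx t; have := expR_ge1Dx (- t).
  by have := expR_gt0 t; have := expR_gt0 (- t); lra.
have -> : gexp s (a + 1) y = expR (2 * pi * y) * gexp s a y.
  by rewrite -expRD; congr expR; ring.
have -> : gexp s (a - 1) y = expR (- (2 * pi * y)) * gexp s a y.
  by rewrite -expRD; congr expR; ring.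
rewrite -mulrDl mulrA ler_pM2r ?gexp_gt0 //.
have := h (2 * pi * y); rewrite normrM gtr0_norm // mulr_gt0 //.
Qed.


Lemma gexp_le s a y : 0 < s -> gexp s a y <= expR (pi * (a ^+ 2 / s)).
Proof.
move=> s0; rewrite ler_expR ler_pM2l ?pi_gt0 // -subr_ge0.
have -> : a ^+ 2 / s - (2 * a * y - s * y ^+ 2) = (a - s * y) ^+ 2 / s.
  by field; rewrite gt_eqF.
by rewrite divr_ge0 ?sqr_ge0 ?ltW.
Qed.

(** Bounding the right side of [mul_gexp_le] by the maxima of the two shifted functions shows that
    [gexp s a y] is [O(1 / |y|)]. The sequence form covers both ends of [[-(n+1), n+1]] and the
    progressions used for linear independence. *)
Lemma cvg_gexp s a (u : R^nat) : 0 < s -> (forall n, n.+1%:R <= `|u n|) ->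
  gexp s a (u n) @[n --> \oo] --> 0.
Proof.
move=> s0 un; have pi0 := pi_gt0 R.
pose M := expR (pi * ((a + 1) ^+ 2 / s)) + expR (pi * ((a - 1) ^+ 2 / s)).
apply: (@squeeze_cvgr _ _ _ _ (cst 0) (fun n => M / (2 * pi) * harmonic n)).
- apply: nearW => n; rewrite ltW ?gexp_gt0 //= /harmonic.
  have n0 : 0 < `|u n| by apply: lt_le_trans (un n).
  apply: (@le_trans _ _ (M / (2 * pi) / `|u n|)); last first.
    rewrite ler_wpM2l ?lef_pV2 ?posrE // divr_ge0 ?addr_ge0 ?expR_ge0 //.
    by rewrite mulr_ge0 // ltW.
  rewrite ler_pdivlMr // ler_pdivlMr ?mulr_gt0 // mulrC (mulrC (gexp _ _ _)).
  by rewrite (le_trans (mul_gexp_le _ _ _)) // lerD ?gexp_le.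
- exact: cvg_cst.
- by rewrite -[X in _ --> X](mulr0 (M / (2 * pi))); apply: cvgMr; exact: cvg_harmonic.
Qed.

(** The fundamental theorem of calculus on [[-(n+1), n+1]], then dominated convergence with bound
    [|f|]. *)
Lemma Rintegral_derive_eq0 (F f : R -> R) :
    (forall y, is_derive y 1 F (f y)) -> continuous f ->
    mu.-integrable setT (EFin \o f) ->
    F n.+1%:R @[n --> \oo] --> 0 -> F (- n.+1%:R) @[n --> \oo] --> 0 ->
  \int[mu]_y f y = 0.
Proof.
move=> dF cf intf Fp Fm.
have cF : continuous F.
  by move=> y; apply/differentiable_continuous/derivable1_diffP; exact: ex_derive.
pose A (n : nat) : set R := [set` `[(- n.+1%:R), n.+1%:R]].
have FA n : (\int[mu]_y ((EFin \o f) \_ (A n)) y = (F n.+1%:R - F (- n.+1%:R))%:E)%E.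
  rewrite -integral_mkcond (@continuous_FTC2 _ f F) //.
  - by rewrite gtrN ?ltr0n.
  - exact: continuous_subspaceT.
  - split=> [x _||]; first exact: ex_derive.
      exact/cvg_at_right_filter/cF.
    exact/cvg_at_left_filter/cF.
  - by move=> x _; rewrite derive1E derive_val.
have : (\int[mu]_y ((EFin \o f) \_ (A n)) y @[n --> \oo] --> \int[mu]_y (f y)%:E)%E.
  apply: (@dominated_cvg _ _ _ mu _ _ _ _ (fun y => `|(f y)%:E|%E)) => //.
  - move=> n; apply/(measurable_restrictT _ _).1; first exact: measurable_itv.
    by apply: measurable_funS (measurable_int mu intf).
  (* At a fixed [x] the truncation equals [f x] as soon as [n] exceeds an integer bound of [|x|]. *)
  - move=> x _; apply: cvg_near_cst.
    exists (Num.bound `|x|) => // n /= le_n; rewrite patchE mem_set // /A /= in_itv /=.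
    have : `|x| < n.+1%:R.
      apply: lt_le_trans (archi_boundP _) _ => //.
      by rewrite ler_nat leqW.
    by move/ltW; rewrite ler_norml.
  - exact: integrable_abse.
  - by move=> n x _; rewrite patchE; case: ifP => // _; rewrite abse0.
have fi : (\int[mu]_y (f y)%:E)%E \is a fin_num by exact: integrable_fin_num.
under eq_fun do rewrite FA; rewrite -(fineK fi) => /fine_cvg /= h1.
have h2 : F n.+1%:R - F (- n.+1%:R) @[n --> \oo] --> (0 - 0 : R) by exact: cvgB.
by rewrite /Rintegral (cvg_unique _ h1 h2) //= subrr.
Qed.

End RealGaussian.

Section ComplexGaussian.
Variable R : realType.
Implicit Types s a b y t : R.
Local Notation mu := (@lebesgue_measure R).

(** The term [B * |y|] is absorbed by [mul_gexp_le], at the price of the factor [1 / (2 pi)] in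
    [B']. *)
Lemma integrable_gexpM s a (A B : R) (h : R -> R) : 0 < s -> continuous h ->
    (forall y, `|h y| <= A + B * `|y|) ->
  mu.-integrable setT (EFin \o (fun y => gexp s a y * h y)).
Proof.
move=> s0 ch hAB; have pi0 := pi_gt0 R.
pose B' := `|B| / (2 * pi).
pose g y := `|A| * gexp s a y + B' * (gexp s (a + 1) y + gexp s (a - 1) y).
have intg : mu.-integrable setT (EFin \o g).
  pose G y := (`|A|%:E * (gexp s a y)%:E +
     (B'%:E * ((gexp s (a + 1) y)%:E + (gexp s (a - 1) y)%:E)))%E.
  have : mu.-integrable setT G; last by apply: eq_integrable.
  apply: integrableD => //; apply: integrableZl => //.
    exact: integrable_gexp.
  by apply: integrableD => //; exact: integrable_gexp.
apply: le_integrable intg => //.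
  apply/measurable_EFinP/measurable_funM; first exact: measurable_gexp.
  exact: continuous_measurable_fun.
move=> y _; rewrite /= lee_fin normrM gtr0_norm ?gexp_gt0 //.
apply: le_trans (ler_norm _).
have gy := gexp_gt0 s a y; apply: (@le_trans _ _ (gexp s a y * (`|A| + `|B| * `|y|))).
  rewrite ler_pM2l //; apply: le_trans (hAB y) _; rewrite lerD ?ler_norm //.
  by rewrite ler_wpM2r ?ler_norm.
rewrite mulrDr [X in X + _]mulrC lerD2l /B' mulrAC ler_pdivlMr ?mulr_gt0 //.
have -> : gexp s a y * (`|B| * `|y|) * (2 * pi) = `|B| * (2 * pi * (`|y| * gexp s a y)).
  by ring.
by rewrite ler_wpM2l // mul_gexp_le.
Qed.

Lemma continuous_is_derive (f df : R -> R) :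
  (forall y, is_derive y 1 f (df y)) -> continuous f.
Proof.
move=> dfP y; apply/differentiable_continuous/derivable1_diffP.
exact: ex_derive.
Qed.

Lemma is_derive_cos_affine (k t y : R) :
  is_derive y 1 (fun y => cos (k * y + t)) (- k * sin (k * y + t)).
Proof.
rewrite [fun _ => _](_ : _ = cos \o (k *: id + cst t)); last exact/funext.
apply: is_derive_eq.
by rewrite /GRing.scale /= !fctE /=; ring.
Qed.

Lemma is_derive_sin_affine (k t y : R) :
  is_derive y 1 (fun y => sin (k * y + t)) (k * cos (k * y + t)).
Proof.
rewrite [fun _ => _](_ : _ = sin \o (k *: id + cst t)); last exact/funext.
apply: is_derive_eq.
by rewrite /GRing.scale /= !fctE /=; ring.
Qed.

(** The phase [t] lets one function serve for both parts of the complex integral: the sine integral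
    is the value at [t - pi / 2]. *)
Definition gauss_cos s a b t : R := \int[mu]_y (gexp s a y * cos (2 * pi * b * y + t)).

Lemma normr_cos_le1 t : `|cos t| <= 1.
Proof. by rewrite ler_norml cos_le1 cos_geN1. Qed.

Lemma normr_sin_le1 t : `|sin t| <= 1.
Proof. by rewrite ler_norml sin_le1 sin_geN1. Qed.

Lemma continuous_cos_affine k t : continuous (fun y => cos (k * y + t)).
Proof. by apply: continuous_is_derive => y; exact: is_derive_cos_affine. Qed.

Lemma continuous_sin_affine k t : continuous (fun y => sin (k * y + t)).
Proof. by apply: continuous_is_derive => y; exact: is_derive_sin_affine. Qed.

Lemma integrable_gexp_cos s a k t : 0 < s ->
  mu.-integrable setT (EFin \o (fun y => gexp s a y * cos (k * y + t))).
Proof.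
move=> s0; apply: (@integrable_gexpM _ _ 1 0) => //; first exact: continuous_cos_affine.
by move=> y; rewrite mul0r addr0 normr_cos_le1.
Qed.

Lemma integrable_gexp_sin s a k t : 0 < s ->
  mu.-integrable setT (EFin \o (fun y => gexp s a y * sin (k * y + t))).
Proof.
move=> s0; apply: (@integrable_gexpM _ _ 1 0) => //; first exact: continuous_sin_affine.
by move=> y; rewrite mul0r addr0 normr_sin_le1.
Qed.

Lemma integrable_gexp_idsin s a k t : 0 < s ->
  mu.-integrable setT (EFin \o (fun y => gexp s a y * (y * sin (k * y + t)))).
Proof.
move=> s0; apply: (@integrable_gexpM _ _ 0 1) => //.
  by move=> y; apply: cvgM; [exact: cvg_id|exact: continuous_sin_affine].
by move=> y; rewrite add0r mul1r normrM ler_piMr ?normr_sin_le1.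
Qed.

Lemma gauss_cos_shift s a b t :
  gauss_cos s a b (t - pi / 2) = \int[mu]_y (gexp s a y * sin (2 * pi * b * y + t)).
Proof.
apply: eq_Rintegral => y _; congr (_ * _).
by rewrite addrA cosB cos_pihalf sin_pihalf mulr0 add0r mulr1.
Qed.

(** Integration by parts: [F] tends to 0 at both ends, so the integral of its derivative [f]
    vanishes, and the equation is solved for the term containing [y]. This expresses the derivative
    of [gauss_cos] in [b] through [gauss_cos] itself. *)
Lemma gauss_idsin s a b t : 0 < s ->
  \int[mu]_y (gexp s a y * (y * sin (2 * pi * b * y + t))) =
  s^-1 * (a * gauss_cos s a b (t - pi / 2) + b * gauss_cos s a b t).
Proof.
move=> s0; have pi0 := pi_gt0 R.
pose S y := sin (2 * pi * b * y + t); pose C y := cos (2 * pi * b * y + t).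
pose F y := gexp s a y * S y.
pose f y := (2 * pi * a) * (gexp s a y * S y) + (2 * pi * b) * (gexp s a y * C y)
   - (2 * pi * s) * (gexp s a y * (y * S y)).
have dF y : is_derive y 1 F (f y).
  have := is_derive_sin_affine (2 * pi * b) t y => dS.
  rewrite [F](_ : _ = gexp s a * S) //.
  by apply: is_derive_eq; rewrite /GRing.scale /= /f /S /C; ring.
have iS : mu.-integrable setT (EFin \o (fun y => gexp s a y * S y)).
  exact: integrable_gexp_sin.
have iC : mu.-integrable setT (EFin \o (fun y => gexp s a y * C y)).
  exact: integrable_gexp_cos.
have iY : mu.-integrable setT (EFin \o (fun y => gexp s a y * (y * S y))).
  exact: integrable_gexp_idsin.
have intZ k (h : R -> R) : mu.-integrable setT (EFin \o h) ->
    mu.-integrable setT (EFin \o (fun y => k * h y)).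
  by move=> ih; exact: (integrableZl _ _ ih).
have intD (h1 h2 : R -> R) : mu.-integrable setT (EFin \o h1) ->
    mu.-integrable setT (EFin \o h2) ->
    mu.-integrable setT (EFin \o (fun y => h1 y + h2 y)).
  by move=> i1 i2; exact: (integrableD _ i1 i2).
have cf : continuous f.
  have cg := @continuous_gexp R s a.
  have cS : continuous S by exact: continuous_sin_affine.
  have cC : continuous C by exact: continuous_cos_affine.
  move=> y; apply: cvgB; first apply: cvgD.
  - by apply: cvgM; [exact: cvg_cst|apply: cvgM; [exact: cg|exact: cS]].
  - by apply: cvgM; [exact: cvg_cst|apply: cvgM; [exact: cg|exact: cC]].
  - apply: cvgM; [exact: cvg_cst|apply: cvgM; first exact: cg].
    by apply: cvgM; [exact: cvg_id|exact: cS].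
have If : mu.-integrable setT (EFin \o f).
  apply: (integrableB _ (intD _ _ (intZ _ _ iS) (intZ _ _ iC)) (intZ _ _ iY)) => //.
have cvF (u : R^nat) : (forall n, n.+1%:R <= `|u n|) -> F (u n) @[n --> \oo] --> 0.
  move=> un; apply: norm_cvg0.
  apply: (@squeeze_cvgr _ _ _ _ (cst 0) (fun n => gexp s a (u n))).
  - apply: nearW => n; rewrite normr_ge0 /= normrM gtr0_norm ?gexp_gt0 //.
    by rewrite ler_piMr ?normr_sin_le1 // ltW ?gexp_gt0.
  - exact: cvg_cst.
  - exact: cvg_gexp.
have : \int[mu]_y f y = 0.
  apply: (Rintegral_derive_eq0 dF cf If); apply: cvF => n.
    by rewrite ger0_norm.
  by rewrite normrN ger0_norm.
rewrite /f RintegralB //; [|by apply: intD; exact: intZ|exact: intZ].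
rewrite RintegralD //; [|exact: intZ|exact: intZ].
rewrite !RintegralZl // gauss_cos_shift /gauss_cos -/S -/C.
rewrite -[\int[mu]_x (gexp s a x * cos _)]/(\int[mu]_x (gexp s a x * C x)).
rewrite -[\int[mu]_x (gexp s a x * sin _)]/(\int[mu]_x (gexp s a x * S x)).
rewrite -[\int[mu]_x (gexp s a x * (x * sin _))]/(\int[mu]_x (gexp s a x * (x * S x))).
set IS := Rintegral _ _ _; set IC := Rintegral _ _ _; set IY := Rintegral _ _ _.
move: (pi : R) pi0 => p p0 {}f0.
apply: (@mulfI _ (2 * p * s)); first by rewrite gt_eqF ?mulr_gt0.
have -> : 2 * p * s * IY = 2 * p * a * IS + 2 * p * b * IC by lra.
by field; rewrite gt_eqF.
Qed.

End ComplexGaussian.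

(** * The Gaussian integral as a function of the frequency *)

Section ComplexGaussianValue.
Variable R : realType.
Implicit Types s a b y t : R.
Local Notation mu := (@lebesgue_measure R).

(** Differentiation under the integral sign brings down [y * sin], which [gauss_idsin] evaluates. *)
Lemma is_derive_gauss_cos s a t b : 0 < s ->
  is_derive b 1 (fun b => gauss_cos s a b t)
    (- (2 * pi / s) * (a * gauss_cos s a b (t - pi / 2) + b * gauss_cos s a b t)).
Proof.
move=> s0; have pi0 := pi_gt0 R.
pose f b y := gexp s a y * cos (2 * pi * b * y + t).
have df (x y : R) : is_derive x 1 (f ^~ y)
    (- (2 * pi) * (gexp s a y * (y * sin (2 * pi * x * y + t)))).
  have d := is_derive_cos_affine (2 * pi * y) t x.
  rewrite [f ^~ y](_ : _ =
    gexp s a y *: (fun b => cos (2 * pi * y * b + t))); last first.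
    by apply/funext => z; rewrite /f /= mulrAC.
  apply: is_derive_eq; have -> : 2 * pi * y * x = 2 * pi * x * y by ring.
  by rewrite /GRing.scale /=; ring.
pose G y := gexp s (a + 1) y + gexp s (a - 1) y.
have intG : mu.-integrable setT (EFin \o G).
  by apply: (integrableD _ (integrable_gexp _ s0) (integrable_gexp _ s0)).
have d1E x y : partial1of2 f x y =
    - (2 * pi) * (gexp s a y * (y * sin (2 * pi * x * y + t))).
  by rewrite partial1of2E derive_val.
(* Any neighbourhood of [b] would do, since the bound [G] does not depend on the frequency. *)
have bI : `]b - 1, b + 1[%classic b by rewrite /= in_itv /= ltrBlDr ltrDl ltr01.
have G0 y : 0 <= G y by rewrite addr_ge0 // ltW ?gexp_gt0.
have Gub x y : `]b - 1, b + 1[%classic x -> setT y -> `|partial1of2 f x y| <= G y.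
  move=> _ _; rewrite d1E; apply: le_trans (mul_gexp_le _ _ _).
  have p0 : 0 < 2 * pi :> R by rewrite mulr_gt0.
  rewrite normrM normrN (gtr0_norm p0) ler_pM2l //.
  rewrite normrM gtr0_norm ?gexp_gt0 // mulrC ler_pM2r ?gexp_gt0 //.
  by rewrite normrM ler_piMr ?normr_sin_le1.
have intf x : `]b - 1, b + 1[%classic x -> mu.-integrable setT (EFin \o f x).
  by move=> _; exact: integrable_gexp_cos.
have derf x y : `]b - 1, b + 1[%classic x -> setT y -> derivable (f ^~ y) x 1.
  by move=> _ _; exact: ex_derive.
apply: DeriveDef.
  exact: (derivable_under_integral measurableT bI intf derf G0 intG Gub).
rewrite -derive1E (differentiation_under_integral measurableT bI intf derf G0 intG Gub).
under eq_Rintegral do rewrite d1E.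
rewrite RintegralZl //; last exact: integrable_gexp_idsin.
rewrite gauss_idsin //; move: (pi : R) pi0 => p p0.
by field; rewrite gt_eqF.
Qed.


(* [C + iS] solves [Z' = - 2 q (b - ia) Z], so [Z exp (q (b - ia)^2)] is
   constant *)
Lemma gauss_ode q a (C S : R -> R) :
    (forall x : R, is_derive x 1 C (- (2 * q) * (a * S x + x * C x))) ->
    (forall x : R, is_derive x 1 S (2 * q * (a * C x - x * S x))) ->
  S 0 = 0 -> forall b,
    C b = C 0 * expR (- (q * (b * b))) * cos (2 * q * a * b) /\
    S b = C 0 * expR (- (q * (b * b))) * sin (2 * q * a * b).
Proof.
move=> dC dS S0 b.
pose E (x : R) := expR (q * (x * x)).
have dE (x : R) : is_derive x 1 E (2 * q * x * E x).
  have d : is_derive x (1 : R) (q *: (id * id)) (2 * q * x).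
    by apply: is_derive_eq; rewrite /GRing.scale /=; ring.
  rewrite [E](_ : _ = expR \o (q *: (id * id))); last exact/funext.
  by apply: is_derive_eq (is_derive1_comp (is_derive_expR _) d) _; rewrite mulrC.
pose k := 2 * q * a.
pose c x := cos (k * x + 0); pose d x := sin (k * x + 0).
have dc (x : R) : is_derive x 1 c (- k * d x) by exact: is_derive_cos_affine.
have dd (x : R) : is_derive x 1 d (k * c x) by exact: is_derive_sin_affine.
have cd : c b ^+ 2 + d b ^+ 2 = 1 by rewrite cos2Dsin2.
have Eb : E b * expR (- (q * (b * b))) = 1 by rewrite -expRD subrr expR0.
have -> : 2 * q * a * b = k * b + 0 by rewrite addr0.
rewrite -/(c b) -/(d b).
have E0 : E 0 = 1 by rewrite /E !mulr0 expR0.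
have c0 : c 0 = 1 by rewrite /c mulr0 addr0 cos0.
have d0 : d 0 = 0 by rewrite /d mulr0 addr0 sin0.
move: (expR _) Eb => e Eb; clearbody E c d.
(* [P_const] and [Q_const] are the real and imaginary parts of [(C + iS) (c - id) E], a constant
   multiple of the conserved quantity. As [c^2 + d^2 = 1], the two equations can be solved for [C]
   and [S]. *)
have P_const x : E x * (C x * c x + S x * d x) = C 0.
  have -> : E x * (C x * c x + S x * d x) = E 0 * (C 0 * c 0 + S 0 * d 0).
    apply: (@is_derive_0_is_cst _ (E * (C * c + S * d))) => {}x.
    apply: is_derive_eq (is_deriveM (dE x)
      (is_deriveD (is_deriveM (dC x) (dc x)) (is_deriveM (dS x) (dd x)))) _.
    rewrite /GRing.scale /= !fctE /k.
    by ring.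
  by rewrite E0 c0 d0; ring.
have Q_const x : E x * (S x * c x - C x * d x) = 0.
  have -> : E x * (S x * c x - C x * d x) = E 0 * (S 0 * c 0 - C 0 * d 0).
    apply: (@is_derive_0_is_cst _ (E * (S * c - C * d))) => {}x.
    apply: is_derive_eq (is_deriveM (dE x)
      (is_deriveB (is_deriveM (dS x) (dc x)) (is_deriveM (dC x) (dd x)))) _.
    rewrite /GRing.scale /= !fctE /k.
    by ring.
  by rewrite E0 c0 d0 S0; ring.
have P := P_const b; have Q := Q_const b.
split.
  transitivity ((E b * e) * C b * (c b ^+ 2 + d b ^+ 2)); first by rewrite Eb cd; ring.
  rewrite -P; transitivity (E b * e * ((C b * c b + S b * d b) * c b)
     - e * d b * (E b * (S b * c b - C b * d b))); first by ring.
  by rewrite Q; ring.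
transitivity ((E b * e) * S b * (c b ^+ 2 + d b ^+ 2)); first by rewrite Eb cd; ring.
rewrite -P; transitivity (E b * e * ((C b * c b + S b * d b) * d b)
   + e * c b * (E b * (S b * c b - C b * d b))); first by ring.
by rewrite Q; ring.
Qed.

(** This is the real part of [s^(-1/2) exp (pi (a + ib)^2 / s) e^(it)]. The phases 0 and [- pi / 2]
    give the solution of [gauss_ode] with [q = pi / s]; a general phase follows from the addition
    formula. *)
Lemma gauss_cosE s a b t : 0 < s -> gauss_cos s a b t =
  (Num.sqrt s)^-1 * expR (pi * ((a ^+ 2 - b ^+ 2) / s)) *
    cos (2 * pi * (a * b / s) + t).
Proof.
move=> s0.
pose C x := gauss_cos s a x 0; pose S x := gauss_cos s a x (- (pi / 2)).
have dC (x : R) : is_derive x 1 C (- (2 * (pi / s)) * (a * S x + x * C x)).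
  by have := is_derive_gauss_cos a 0 x s0; rewrite sub0r -mulrA.
have dS (x : R) : is_derive x 1 S (2 * (pi / s) * (a * C x - x * S x)).
  have := is_derive_gauss_cos a (- (pi / 2)) x s0.
  (* Differentiating [S] lowers its phase by a second quarter turn; the half turn only changes the
     sign, which closes the system on [C] and [S]. *)
  have -> : gauss_cos s a x (- (pi / 2) - pi / 2) = - C x.
    have <- : -1 * gauss_cos s a x 0 = - C x by rewrite mulN1r.
    rewrite -RintegralZl //; last exact: integrable_gexp_cos.
    apply: eq_Rintegral => y _; rewrite -opprD -splitr addr0 -cosN opprD opprK.
    by rewrite cosDpi cosN; ring.
  by rewrite -/(S x) => d; apply: (is_derive_eq d);
    move: (C x) (S x) (pi : R) => C1 S1 p; ring.
have S0 : S 0 = 0.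
  rewrite /S -[- _]add0r gauss_cos_shift.
  under eq_Rintegral do rewrite mulr0 mul0r addr0 sin0 mulr0.
  by rewrite Rintegral_cst // mul0r.
have C0 : C 0 = (Num.sqrt s)^-1 * expR (pi * (a ^+ 2 / s)).
  rewrite -Rintegral_gexp //; apply: eq_Rintegral => y _.
  by rewrite mulr0 mul0r addr0 cos0 mulr1.
have -> : expR (pi * ((a ^+ 2 - b ^+ 2) / s)) =
    expR (pi * (a ^+ 2 / s)) * expR (- (pi / s * (b * b))).
  by rewrite -expRD; congr expR; move: (pi : R) => p; ring.
have -> : gauss_cos s a b t = C b * cos t - S b * sin t.
  rewrite /S -[- (pi / 2)]add0r gauss_cos_shift /C /gauss_cos.
  rewrite -!RintegralZr //; [|exact: integrable_gexp_sin|exact: integrable_gexp_cos].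
  rewrite -RintegralB //.
  - by apply: eq_Rintegral => y _; rewrite !addr0 cosD; ring.
  - apply: eq_integrable (integrableZr measurableT (cos t)
        (integrable_gexp_cos a (2 * pi * b) 0 s0)) => //.
  - apply: eq_integrable (integrableZr measurableT (sin t)
        (integrable_gexp_sin a (2 * pi * b) 0 s0)) => //.
have [-> ->] := gauss_ode dC dS S0 b.
have -> : 2 * pi * (a * b / s) = 2 * (pi / s) * a * b by move: (pi : R) => p; ring.
rewrite cosD [_ * (expR _ * _)]mulrA -C0.
by move: (C 0) (expR _) (sin _) (cos _) => C1 e c d; ring.
Qed.

End ComplexGaussianValue.

(** * Bilinear maps on free modules *)

Section FreeModule.
Variables (F : fieldType) (K : choiceType).
Local Notation M := {freeg K / F}.

Lemma freegZU (c d : F) (k : K) : c *: << d *g k >> = << c * d *g k >> :> M.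
Proof. by apply/eqP/freeg_eqP => x; rewrite coeffZ !coeffU mulrA. Qed.

Lemma fglift_linear (V : lmodType F) (f : K -> V) : linear (fglift f).
Proof.
have l0 : fglift f (0 : M) = 0.
  by rewrite -[X in fglift f X](subrr (0 : M)) lift_is_additive subrr.
have lD (a b : M) : fglift f (a + b) = fglift f a + fglift f b.
  have -> : a + b = a - (0 - b) by rewrite sub0r opprK.
  by rewrite !lift_is_additive l0 sub0r opprK.
have lZ c (a : M) : fglift f (c *: a) = c *: fglift f a.
  elim/freeg_ind_dom0: a => [|d k a _ _ IH]; first by rewrite scaler0 l0 scaler0.
  by rewrite scalerDr freegZU !lD IH !liftU scalerDr scalerA.
by move=> c a b; rewrite lD lZ.
Qed.

Lemma linear_at0 (V W : lmodType F) (f : V -> W) : linear f -> f 0 = 0.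
Proof.
move=> fl; have := fl (-1) 0 0.
by rewrite scaler0 addr0 scaleN1r addNr.
Qed.

Lemma freeg_linear_ext (V : lmodType F) (f g : M -> V) :
  linear f -> linear g -> (forall k, f << k >> = g << k >>) -> f =1 g.
Proof.
move=> fl gl fg; elim/freeg_ind_dom0 => [|d k a _ _ IH].
  by rewrite !linear_at0.
by rewrite -[d]mulr1 -freegZU fl gl fg IH.
Qed.

Lemma fgliftU1 (V : lmodType F) (f : K -> V) k : fglift f << k >> = f k.
Proof. by rewrite liftU scale1r. Qed.

Lemma fglift_linear_fun (V : lmodType F) (f g : K -> V) c (a : M) :
  fglift (fun k => c *: f k + g k) a = c *: fglift f a + fglift g a.
Proof.
move: a; apply: freeg_linear_ext => [|d a b|k]; first exact: fglift_linear.
  by rewrite !fglift_linear !scalerDr !scalerA mulrC addrACA.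
by rewrite !fgliftU1.
Qed.

Section Bilinear.
Variable op : K -> K -> M.

Definition bilift (a b : M) : M := fglift (fun k => fglift (op k) b) a.

Lemma bilift_linearl b : linear (bilift^~ b).
Proof. exact: fglift_linear. Qed.

Lemma bilift_linearr a : linear (bilift a).
Proof.
move=> c b b'; rewrite /bilift -fglift_linear_fun; congr (fglift _ a).
by apply/funext => k; rewrite fglift_linear.
Qed.

Lemma biliftU k l : bilift << k >> << l >> = op k l.
Proof. by rewrite /bilift !fgliftU1. Qed.

Lemma biliftC : (forall k l, op k l = op l k) -> commutative bilift.
Proof.
move=> opC a b; move: a; apply: freeg_linear_ext => [||k].
- exact: bilift_linearl.
- exact: bilift_linearr.
- move: b; apply: freeg_linear_ext => [||l].
  + exact: bilift_linearr.
  + exact: bilift_linearl.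
  + by rewrite !biliftU opC.
Qed.

Lemma biliftA :
    (forall k l m, bilift << k >> (op l m) = bilift (op k l) << m >>) ->
  associative bilift.
Proof.
move=> opA a b c; move: a; apply: freeg_linear_ext => [||k].
- exact: bilift_linearl.
- by move=> d a a'; rewrite !bilift_linearl.
move: b; apply: freeg_linear_ext => [||l].
- by move=> d a a'; rewrite bilift_linearl bilift_linearr.
- by move=> d a a'; rewrite bilift_linearr bilift_linearl.
move: c; apply: freeg_linear_ext => [||m].
- by move=> d a a'; rewrite !bilift_linearr.
- exact: bilift_linearr.
by rewrite !biliftU opA.
Qed.

End Bilinear.
End FreeModule.

Lemma bilinear_ext (F : fieldType) (K : choiceType) (V : lmodType F)
    (f g : {freeg K / F} -> {freeg K / F} -> V) :
    (forall b, linear (f^~ b)) -> (forall a, linear (f a)) ->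
    (forall b, linear (g^~ b)) -> (forall a, linear (g a)) ->
    (forall k l, f << k >> << l >> = g << k >> << l >>) ->
  forall a b, f a b = g a b.
Proof.
move=> fl fr gl gr fg a b; move: a; apply: freeg_linear_ext => // k.
by move: b; apply: freeg_linear_ext.
Qed.

(** * The algebra of formal Gaussians *)

Section ComplexRationals.
Variable R : realType.
Implicit Types (w z : rat[i]) (r s : rat).

Lemma ratCD r s : (r + s)%:C = r%:C + s%:C :> rat[i]. Proof. exact: rmorphD. Qed.
Lemma ratCM r s : (r * s)%:C = r%:C * s%:C :> rat[i]. Proof. exact: rmorphM. Qed.
Lemma ratCN r : (- r)%:C = - r%:C :> rat[i]. Proof. exact: rmorphN. Qed.
Lemma ratCV r : r^-1%:C = r%:C^-1 :> rat[i]. Proof. exact: fmorphV. Qed.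
Definition ratCE := (ratCD, ratCM, ratCN, ratCV).

Lemma ratC_neq0 r : 0 < r -> r%:C != 0 :> rat[i].
Proof. by move=> r0; rewrite eq_complex /= gt_eqF. Qed.

Definition cratr w : R[i] := let: a +i* b := w in ratr a +i* ratr b.

Fact cratr_is_additive : additive cratr.
Proof. by move=> [a b] [c d] /=; rewrite !rmorphB. Qed.

Fact cratr_is_monoid_morphism : monoid_morphism cratr.
Proof.
split=> [|[a b] [c d]]; first by rewrite /cratr /= rmorph1 rmorph0.
by rewrite /cratr /= rmorphB rmorphD !rmorphM.
Qed.

HB.instance Definition _ :=
  GRing.isAdditive.Build rat[i] R[i] cratr cratr_is_additive.
HB.instance Definition _ :=
  GRing.isMonoidMorphism.Build rat[i] R[i] cratr cratr_is_monoid_morphism.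

Lemma cratr_real r : cratr r%:C = (ratr r)%:C.
Proof. by rewrite /cratr /= rmorph0. Qed.

Definition Qpi_exp w : Qpi R := MkQpi (Qpi_cexp R (complex.Re w) (complex.Im w)).

Lemma Qpi_expE w : Qpi_val (Qpi_exp w) = cexp (pi%:C * cratr w).
Proof. by case: w. Qed.

Lemma Qpi_val_inj : injective (@Qpi_val R).
Proof. exact: val_inj. Qed.

Lemma Qpi_valM (a b : Qpi R) : Qpi_val (a * b) = Qpi_val a * Qpi_val b.
Proof. by []. Qed.

Lemma Qpi_valV (a : Qpi R) : Qpi_val a^-1 = (Qpi_val a)^-1.
Proof. exact: (fmorphV (val : Qpi R -> R[i])). Qed.

Lemma Qpi_expD w z : Qpi_exp (w + z) = Qpi_exp w * Qpi_exp z.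
Proof.
apply: Qpi_val_inj; rewrite Qpi_valM !Qpi_expE -cexpD -mulrDr.
by rewrite [cratr (_ + _)]rmorphD.
Qed.

Lemma Qpi_exp0 : Qpi_exp 0 = 1.
Proof. by apply: Qpi_val_inj; rewrite Qpi_expE [cratr _]rmorph0 mulr0 cexp0. Qed.

Lemma exp_piQE r : exp_piQ R r = Qpi_exp r%:C.
Proof. by apply: Qpi_val_inj; rewrite Qpi_expE cratr_real -rmorphM cexpR. Qed.

Definition imQ r : rat[i] := 0 +i* r.

Lemma imQD r s : imQ (r + s) = imQ r + imQ s.
Proof.
by apply/eqP; rewrite eq_complex /imQ /=; apply/andP; split; apply/eqP; ring.
Qed.

Lemma imQM r s : imQ r * s%:C = imQ (r * s).
Proof.
by apply/eqP; rewrite eq_complex /imQ /=; apply/andP; split; apply/eqP; ring.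
Qed.

Lemma imQE r : imQ r = imQ 1 * r%:C.
Proof. by rewrite imQM mul1r. Qed.

Lemma imQ_sqr r : imQ r ^+ 2 = - (r ^+ 2)%:C.
Proof.
by apply/eqP; rewrite eq_complex /imQ /=; apply/andP; split; apply/eqP; ring.
Qed.

(** With the phases of the Heisenberg group written as [e^(pi z)], an equality of constants reduces
    to an equality of exponents in Q(i). *)
Lemma TQ_etauE r : TQ_Qpi (TQ_etau R r) = Qpi_exp (2 * imQ r).
Proof.
apply: Qpi_val_inj; rewrite Qpi_expE [cratr _]rmorphM rmorph_nat; congr cexp.
by apply/eqP; rewrite eq_complex /= rmorph0; apply/andP; split; apply/eqP; ring.
Qed.

Lemma TQ_QpiM (c d : TQ R) : TQ_Qpi (TQM c d) = TQ_Qpi c * TQ_Qpi d.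
Proof. exact: val_inj. Qed.

Lemma TQ_Qpi1 : TQ_Qpi (TQ1 R) = 1.
Proof. exact: val_inj. Qed.

Lemma sqrtQ1 : sqrtQ R 1 = 1.
Proof. by apply: val_inj; rewrite /= rmorph1 sqrtr1. Qed.

Lemma sqrtQM r s : 0 <= r -> sqrtQ R (r * s) = sqrtQ R r * sqrtQ R s.
Proof.
by move=> r0; apply: val_inj; rewrite /= rmorphM sqrtrM ?ler0q // rmorphM.
Qed.

Lemma sqrtQ_neq0 r : 0 < r -> sqrtQ R r != 0.
Proof.
move=> r0; apply/eqP => /(congr1 val) /= /eqP; rewrite eq_complex /= eqxx andbT.
by rewrite sqrtr_eq0 lerq0 leNgt r0.
Qed.

End ComplexRationals.

Section RationalGaussians.
Variable R : realType.

Definition gkey : choiceType := ({posnum rat} * rat[i])%type.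
Implicit Types k l m : gkey.

Definition gmod := {freeg gkey / Qpi R}.
HB.instance Definition _ := GRing.Lmodule.on gmod.

(* the key [(rho, w)] stands for the function
   [x |-> exp (pi (2 w x - rho x^2))] *)
Local Notation gb rho w := (<< ((rho, w) : gkey) >> : gmod).
Implicit Types (w z : rat[i]) (r s : {posnum rat}) (h : heis R).

Definition gdot k l : gmod := gb (k.1%:num + l.1%:num)%:pos (k.2 + l.2).

(** For keys [(r, w)] and [(s, z)], integrating over [y] gives [exp (pi (2 z x - s x^2 + (w - z + s
    x)^2 / (r + s))) / sqrt (r + s)]. The coefficient is the value at [x = 0]; the new key collects
    the terms in [x^2] and [x]. *)
Definition gstar k l : gmod :=
  (Qpi_exp R ((k.2 - l.2) ^+ 2 / (k.1%:num + l.1%:num)%:C)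
     / sqrtQ R (k.1%:num + l.1%:num)) *:
  gb (k.1%:num * l.1%:num / (k.1%:num + l.1%:num))%:pos
     ((k.2 * l.1%:num%:C + l.2 * k.1%:num%:C) / (k.1%:num + l.1%:num)%:C).

(** By [heis_mul], [c(x, xi)] is [c] times modulation by [xi] followed by translation by [x],
    without extra phase. Substituting [y - x] in the modulated Gaussian leaves the constant
    shown. *)
Definition gact h k : gmod :=
  (TQ_Qpi (heis_c h) * Qpi_exp R (- ((2 * (k.2 + imQ (heis_xi h))
     + (k.1%:num * heis_x h)%:C) * (heis_x h)%:C))) *:
  gb k.1 (k.2 + imQ (heis_xi h) + (k.1%:num * heis_x h)%:C).

Definition gmod_star := bilift gstar.
Definition gmod_dot := bilift gdot.
Definition gmod_hact h : gmod -> gmod := fglift (gact h).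

Lemma gb_eq (r r' : {posnum rat}) w w' :
  r%:num = r'%:num -> w = w' -> gb r w = gb r' w'.
Proof. by move=> /val_inj -> ->. Qed.

Lemma scale_gb (c c' : Qpi R) r r' w w' :
  c = c' -> r%:num = r'%:num -> w = w' -> c *: gb r w = c' *: gb r' w'.
Proof. by move=> -> /gb_eq/[apply] ->. Qed.

Let C0 : 0%:C = 0 :> rat[i]. Proof. by []. Qed.
Let imQ0 : imQ 0 = 0. Proof. by []. Qed.
Let simp0 := (imQ0, C0, mulr0, addr0, oppr0).

Fact gmod_dotC : commutative gmod_dot.
Proof.
by apply: biliftC => k l; apply: gb_eq; rewrite /= addrC.
Qed.

Fact gmod_dotA : associative gmod_dot.
Proof.
by apply: biliftA => k l m; rewrite !biliftU; apply: gb_eq; rewrite /= addrA.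
Qed.

Fact gmod_starC : commutative gmod_star.
Proof.
apply: biliftC => k l; apply: scale_gb => /=.
- by rewrite -[k.2 - l.2]opprB sqrrN [k.1%:num + _]addrC.
- by rewrite [k.1%:num * _]mulrC [k.1%:num + _]addrC.
- by rewrite [k.1%:num + _]addrC [k.2 * _ + _]addrC.
Qed.

Lemma linear_scale (V W : lmodType (Qpi R)) (f : V -> W) c a :
  linear f -> f (c *: a) = c *: f a.
Proof. by move=> fl; rewrite -[c *: a]addr0 fl linear_at0 // addr0. Qed.

Fact gmod_starA : associative gmod_star.
Proof.
apply: biliftA => -[r w] [s z] [t y].
rewrite /gstar (linear_scale _ _ (bilift_linearr _ _)).
rewrite (linear_scale _ _ (bilift_linearl _ _)).
rewrite !biliftU /gstar !scalerA /=; apply: scale_gb => /=.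
(* The square roots agree only after merging: [(s + t) (r + st / (s + t))] and
   [(r + s) (rs / (r + s) + t)] are both [rs + rt + st]. *)
- rewrite mulrACA -invfM [RHS]mulrACA -invfM -!Qpi_expD -!sqrtQM //.
  have r0 : 0 < r%:num by []; have s0 : 0 < s%:num by []; have t0 : 0 < t%:num by [].
  move: r%:num s%:num t%:num r0 s0 t0 => {}r {}s {}t r0 s0 t0.
  have h1 := ratC_neq0 (addr_gt0 r0 s0); have h2 := ratC_neq0 (addr_gt0 s0 t0).
  have h0 : 0 < r * s + t * (r + s) by rewrite addr_gt0 ?mulr_gt0 ?addr_gt0.
  have h3 := ratC_neq0 h0; rewrite !ratCE in h1 h2 h3.
  congr (Qpi_exp R _ / sqrtQ R _).
    by rewrite !ratCE; field; rewrite h1 h2 h3.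
  by field; rewrite !gt_eqF ?addr_gt0.
- have r0 : 0 < r%:num by []; have s0 : 0 < s%:num by []; have t0 : 0 < t%:num by [].
  move: r%:num s%:num t%:num r0 s0 t0 => {}r {}s {}t r0 s0 t0.
  have h0 : 0 < r * s + t * (r + s) by rewrite addr_gt0 ?mulr_gt0 ?addr_gt0.
  have h0' : 0 < r * (s + t) + s * t by rewrite addr_gt0 ?mulr_gt0 ?addr_gt0.
  by field; rewrite ?(gt_eqF h0) ?(gt_eqF h0') !gt_eqF ?addr_gt0.
- have r0 : 0 < r%:num by []; have s0 : 0 < s%:num by []; have t0 : 0 < t%:num by [].
  move: r%:num s%:num t%:num r0 s0 t0 => {}r {}s {}t r0 s0 t0.
  have h1 := ratC_neq0 (addr_gt0 r0 s0); have h2 := ratC_neq0 (addr_gt0 s0 t0).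
  have h0 : 0 < r * s + t * (r + s) by rewrite addr_gt0 ?mulr_gt0 ?addr_gt0.
  have h0' : 0 < r * (s + t) + s * t by rewrite addr_gt0 ?mulr_gt0 ?addr_gt0.
  have h3 := ratC_neq0 h0; have h4 := ratC_neq0 h0'; rewrite !ratCE in h1 h2 h3 h4.
  by rewrite !ratCE; field; rewrite ?h1 ?h2 ?h3 ?h4.
Qed.

Fact gmod_hact_linear h : linear (gmod_hact h).
Proof. exact: fglift_linear. Qed.

Let hactU h k : gmod_hact h << k >> = gact h k.
Proof. exact: fgliftU1. Qed.

Fact gmod_hact1 a : gmod_hact 1%g a = a.
Proof.
move: a; apply: freeg_linear_ext => // [|[r w]]; first exact: gmod_hact_linear.
rewrite hactU -[RHS]scale1r; apply: scale_gb => //=.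
  by rewrite TQ_Qpi1 mul1r mulr0 oppr0 Qpi_exp0.
by rewrite mulr0 !addr0.
Qed.

Fact gmod_hactM h g a : gmod_hact (h * g)%g a = gmod_hact h (gmod_hact g a).
Proof.
move: a; apply: freeg_linear_ext => [||[r w]].
- exact: gmod_hact_linear.
- by move=> c a b; rewrite !gmod_hact_linear.
rewrite !hactU /gact (linear_scale _ _ (gmod_hact_linear h)) hactU /gact scalerA /=.
case: h g => [c x xi] [d y eta] /=; apply: scale_gb => //=.
  rewrite !TQ_QpiM TQ_etauE -[LHS]mulrA [RHS]mulrACA -!Qpi_expD.
  rewrite [TQ_Qpi d * _]mulrC; congr (_ * Qpi_exp R _).
  rewrite imQD -imQM !ratCE; ring.
by rewrite imQD !ratCE; ring.
Qed.

Fact gmod_hact_scalar c a : gmod_hact (Heis c 0 0) a = TQ_Qpi c *: a.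
Proof.
move: a; apply: freeg_linear_ext => [||[r w]].
- exact: gmod_hact_linear.
- by move=> d a b; rewrite scalerDr !scalerA mulrC.
rewrite hactU; apply: scale_gb => //=.
  by rewrite mulr0 oppr0 Qpi_exp0 mulr1.
by rewrite mulr0 !addr0.
Qed.

Let starl b : linear (gmod_star^~ b). Proof. exact: bilift_linearl. Qed.
Let starr a : linear (gmod_star a). Proof. exact: bilift_linearr. Qed.
Let dotl b : linear (gmod_dot^~ b). Proof. exact: bilift_linearl. Qed.
Let dotr a : linear (gmod_dot a). Proof. exact: bilift_linearr. Qed.
Let starU k l : gmod_star << k >> << l >> = gstar k l. Proof. exact: biliftU. Qed.
Let dotU k l : gmod_dot << k >> << l >> = gdot k l. Proof. exact: biliftU. Qed.

Fact gmod_hact_pos_star x a b : gmod_hact (heis_pos R x) (gmod_star a b) =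
  gmod_star (gmod_hact (heis_pos R x) a) b.
Proof.
move: a b; apply: bilinear_ext.
- by move=> b c a a'; rewrite starl gmod_hact_linear.
- by move=> a c b b'; rewrite starr gmod_hact_linear.
- by move=> b c a a'; rewrite gmod_hact_linear starl.
- by move=> a; exact: starr.
move=> [r w] [s z]; rewrite hactU /gact.
rewrite (linear_scale _ _ (starl _)) !starU.
rewrite (linear_scale _ _ (gmod_hact_linear _)) hactU /gact /gstar !scalerA /=.
have r0 : 0 < r%:num by []; have s0 : 0 < s%:num by [].
have h1 := ratC_neq0 (addr_gt0 r0 s0).
apply: scale_gb => //=; last first.
  by rewrite ?simp0 !ratCE in h1 *; field.
rewrite !TQ_Qpi1 !mul1r mulrAC [RHS]mulrA -!Qpi_expD; congr (Qpi_exp R _ / _).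
by rewrite ?simp0 !ratCE in h1 *; field.
Qed.

Fact gmod_hact_freq_star xi a b : gmod_hact (heis_freq R xi) (gmod_star a b) =
  gmod_star (gmod_hact (heis_freq R xi) a) (gmod_hact (heis_freq R xi) b).
Proof.
move: a b; apply: bilinear_ext.
- by move=> b c a a'; rewrite starl gmod_hact_linear.
- by move=> a c b b'; rewrite starr gmod_hact_linear.
- by move=> b c a a'; rewrite gmod_hact_linear starl.
- by move=> a c b b'; rewrite gmod_hact_linear starr.
move=> [r w] [s z]; rewrite !hactU /gact.
rewrite (linear_scale _ _ (starl _)) (linear_scale _ _ (starr _)) !starU.
rewrite (linear_scale _ _ (gmod_hact_linear _)) hactU /gact /gstar !scalerA /=.
have r0 : 0 < r%:num by []; have s0 : 0 < s%:num by [].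
have h1 := ratC_neq0 (addr_gt0 r0 s0).
apply: scale_gb => //=; last first.
  by rewrite !simp0 !ratCE in h1 *; field.
rewrite !TQ_Qpi1 !simp0.
rewrite Qpi_exp0 !mul1r mulr1.
 congr (Qpi_exp R _ / _).
congr (_ / _); congr (_ ^+ 2); ring.
Qed.

Fact gmod_hact_freq_dot xi a b : gmod_hact (heis_freq R xi) (gmod_dot a b) =
  gmod_dot (gmod_hact (heis_freq R xi) a) b.
Proof.
move: a b; apply: bilinear_ext.
- by move=> b c a a'; rewrite dotl gmod_hact_linear.
- by move=> a c b b'; rewrite dotr gmod_hact_linear.
- by move=> b c a a'; rewrite gmod_hact_linear dotl.
- by move=> a; exact: dotr.
move=> [r w] [s z]; rewrite hactU /gact.
rewrite (linear_scale _ _ (dotl _)) !dotU hactU /gact.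
by apply: scale_gb => //=; [rewrite !simp0|rewrite !simp0; ring].
Qed.

Fact gmod_hact_pos_dot x a b : gmod_hact (heis_pos R x) (gmod_dot a b) =
  gmod_dot (gmod_hact (heis_pos R x) a) (gmod_hact (heis_pos R x) b).
Proof.
move: a b; apply: bilinear_ext.
- by move=> b c a a'; rewrite dotl gmod_hact_linear.
- by move=> a c b b'; rewrite dotr gmod_hact_linear.
- by move=> b c a a'; rewrite gmod_hact_linear dotl.
- by move=> a c b b'; rewrite gmod_hact_linear dotr.
move=> [r w] [s z]; rewrite !hactU /gact.
rewrite (linear_scale _ _ (dotl _)) (linear_scale _ _ (dotr _)) !dotU.
rewrite hactU /gact scalerA /=.
apply: scale_gb => //=; last by rewrite !simp0 !ratCE; ring.
rewrite !TQ_Qpi1 !mul1r -Qpi_expD; congr (Qpi_exp R _).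
by rewrite !simp0 !ratCE; ring.
Qed.

HB.instance Definition _ := isHeisenbergTwain.Build R gmod
  (bilift_linearl gstar) gmod_starA gmod_starC
  (bilift_linearl gdot) gmod_dotA gmod_dotC
  gmod_hact_linear gmod_hact1 gmod_hactM gmod_hact_scalar
  gmod_hact_pos_star gmod_hact_freq_star gmod_hact_freq_dot gmod_hact_pos_dot.

End RationalGaussians.

(** * Presentation of the algebra of formal Gaussians *)

Section TwainMorphisms.
Variables (R : realType) (A B : twainType R) (f : A -> B).
Hypothesis fm : twain_morphism f.

Lemma twain_morphism_linear : linear f. Proof. by case: fm. Qed.
Lemma twain_morphism_star : {morph f : a b / star a b}. Proof. by case: fm. Qed.
Lemma twain_morphism_dot : {morph f : a b / dot a b}. Proof. by case: fm. Qed.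
Lemma twain_morphism_hact h : {morph f : a / hact h a}. Proof. by case: fm. Qed.

Lemma twain_morphism_scale c a : f (c *: a) = c *: f a.
Proof. exact/linear_scale/twain_morphism_linear. Qed.

Lemma twain_morphism0 : f 0 = 0.
Proof. exact/linear_at0/twain_morphism_linear. Qed.

Lemma twain_morphismB a b : f (a - b) = f a - f b.
Proof.
by rewrite -[a - b]addrC -scaleN1r twain_morphism_linear scaleN1r addrC.
Qed.

(** The proof that [f] is a morphism is an argument so that the ideal instances, which depend on it,
    can be attached to the predicate. *)
Definition twain_ker of twain_morphism f : {pred A} := fun a => f a == 0.

Fact twain_ker_add : addr_closed (twain_ker fm).
Proof.
split=> [|a b /eqP fa /eqP fb]; first by apply/eqP; exact: twain_morphism0.
by apply/eqP; rewrite -[a]scale1r twain_morphism_linear fa fb scaler0 addr0.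
Qed.

Fact twain_ker_scale c : {in twain_ker fm, forall a, c *: a \in twain_ker fm}.
Proof. by move=> a /eqP fa; apply/eqP; rewrite twain_morphism_scale fa scaler0. Qed.

Lemma star0r (a : B) : star a 0 = 0.
Proof. rewrite starC; exact: (linear_at0 (star_linearl a)). Qed.

Lemma dot0r (a : B) : dot a 0 = 0.
Proof. rewrite dotC; exact: (linear_at0 (dot_linearl a)). Qed.

Fact twain_ker_star a b : b \in twain_ker fm -> star a b \in twain_ker fm.
Proof. by move=> /eqP fb; apply/eqP; rewrite twain_morphism_star fb star0r. Qed.

Fact twain_ker_dot a b : b \in twain_ker fm -> dot a b \in twain_ker fm.
Proof. by move=> /eqP fb; apply/eqP; rewrite twain_morphism_dot fb dot0r. Qed.

Fact twain_ker_hact h a : a \in twain_ker fm -> hact h a \in twain_ker fm.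
Proof.
move=> /eqP fa; apply/eqP; rewrite twain_morphism_hact fa.
exact: (linear_at0 (hact_linear h)).
Qed.

HB.instance Definition _ := GRing.isAddClosed.Build A (twain_ker fm) twain_ker_add.
HB.instance Definition _ :=
  GRing.isScaleClosed.Build (Qpi R) A (twain_ker fm) twain_ker_scale.
HB.instance Definition _ := isTwainIdeal.Build R A (twain_ker fm)
  twain_ker_star twain_ker_dot twain_ker_hact.

Lemma twain_gen_ker (S : set A) a :
  (forall s, S s -> f s = 0) -> a \in twain_gen S -> f a = 0.
Proof.
move=> S0 /asboolP/(_ (twain_ker fm)) aI; apply/eqP/aI => s Ss.
by apply/eqP/S0.
Qed.

Lemma twain_morphism_star_pow a n : f (star_pow a n) = star_pow (f a) n.
Proof.
case: n => [|n]; first exact: twain_morphism0.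
by rewrite /star_pow !iteropS; elim: n => //= n <-; rewrite twain_morphism_star.
Qed.

Lemma twain_morphism_dot_pow a n : f (dot_pow a n) = dot_pow (f a) n.
Proof.
case: n => [|n]; first exact: twain_morphism0.
by rewrite /dot_pow !iteropS; elim: n => //= n <-; rewrite twain_morphism_dot.
Qed.

Lemma twain_morphism_u a rho : f (u_ a rho) = u_ (f a) rho.
Proof.
by rewrite /u_ twain_morphism_scale twain_morphism_star_pow twain_morphism_dot_pow.
Qed.

Let fE := (twain_morphismB, twain_morphism_scale, twain_morphism_star,
  twain_morphism_dot, twain_morphism_hact, twain_morphism_star_pow,
  twain_morphism_dot_pow, twain_morphism_u).

(** The relations are built from operations that [f] preserves. One inclusion carries relations of
    [u] to those of [gunit]; the other shows that all relations at the class of [u] are classes of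
    relations. *)
Lemma twain_morphism_relations u :
  gaussian_relations (f u) = f @` gaussian_relations u.
Proof.
apply/seteqP; split=> [r|_ [r + <-]].
  case=> [[[al [al' [rho [rho' [r0 r0' ->]]]]]|[mu [mu' [rho [rho' [r0 r0' ->]]]]]]
    |[n [m [n0 m0 ->]]]].
  - eexists; [left; left; exists al, al', rho, rho'; split;
      [exact: r0|exact: r0'|reflexivity]|by rewrite !fE].
  - eexists; [left; right; exists mu, mu', rho, rho'; split;
      [exact: r0|exact: r0'|reflexivity]|by rewrite !fE].
  - eexists; [right; exists n, m; split;
      [exact: n0|exact: m0|reflexivity]|by rewrite !fE].
case=> [[[al [al' [rho [rho' [r0 r0' ->]]]]]|[mu [mu' [rho [rho' [r0 r0' ->]]]]]]
    |[n [m [n0 m0 ->]]]].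
- by left; left; exists al, al', rho, rho'; rewrite !fE.
- by left; right; exists mu, mu', rho, rho'; rewrite !fE.
- by right; exists n, m; rewrite !fE.
Qed.

End TwainMorphisms.

(** * The unit Gaussian satisfies the relations *)

Section GaussianRelations.
Variable R : realType.
Local Notation gb rho w := (<< ((rho, w) : gkey) >> : gmod R).
Implicit Types (r s : {posnum rat}) (w z : rat[i]).

Definition gunit : gmod R := gb 1%:pos 0.

Lemma star_gb k l : star (<< k >> : gmod R) << l >> = gstar R k l.
Proof. exact: biliftU. Qed.

Lemma dot_gb k l : dot (<< k >> : gmod R) << l >> = gdot R k l.
Proof. exact: biliftU. Qed.

Lemma hact_gb h k : hact h (<< k >> : gmod R) = gact h k.
Proof. exact: fgliftU1. Qed.

Lemma star_linearr (A : twainType R) (a : A) : linear (star a).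
Proof. by move=> c b b'; rewrite !(starC a) star_linearl. Qed.

Lemma dot_linearr (A : twainType R) (a : A) : linear (dot a).
Proof. by move=> c b b'; rewrite !(dotC a) dot_linearl. Qed.

Lemma starZr (A : twainType R) (c : Qpi R) (a b : A) : star a (c *: b) = c *: star a b.
Proof. exact/linear_scale/star_linearr. Qed.
Lemma starZl (A : twainType R) (c : Qpi R) (a b : A) : star (c *: a) b = c *: star a b.
Proof. exact: (linear_scale _ _ (star_linearl b)). Qed.
Lemma dotZr (A : twainType R) (c : Qpi R) (a b : A) : dot a (c *: b) = c *: dot a b.
Proof. exact/linear_scale/dot_linearr. Qed.
Lemma dotZl (A : twainType R) (c : Qpi R) (a b : A) : dot (c *: a) b = c *: dot a b.
Proof. exact: (linear_scale _ _ (dot_linearl b)). Qed.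

Lemma hact_freq_gb xi r w : hact (heis_freq R xi) (gb r w) = gb r (w + imQ xi).
Proof.
rewrite hact_gb -[RHS]scale1r; apply: scale_gb => //=.
  by rewrite TQ_Qpi1 mul1r mulr0 oppr0 Qpi_exp0.
by rewrite mulr0 addr0.
Qed.

Lemma hact_pos_gb x r w : hact (heis_pos R x) (gb r w) =
  Qpi_exp R (- ((2 * w + (r%:num * x)%:C) * x%:C)) *: gb r (w + (r%:num * x)%:C).
Proof.
rewrite hact_gb; apply: scale_gb => //=.
  by rewrite TQ_Qpi1 mul1r addr0.
by rewrite addr0.
Qed.

(** The resulting key is a variable tied by an equation on values, so that any positivity proof may
    accompany it. *)
Lemma dot_pow_gb c r s n : s%:num = n.+1%:R * r%:num ->
  dot_pow (c *: gb r 0) n.+1 = c ^+ n.+1 *: gb s 0.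
Proof.
rewrite /dot_pow iteropS; elim: n s => [|n IH] s sE /=.
  by rewrite expr1; congr (_ *: _); apply: gb_eq; rewrite // sE mul1r.
rewrite (IH (n.+1%:R * r%:num)%:pos) // dotZl dotZr scalerA dot_gb -exprS.
apply: scale_gb; rewrite ?addr0 //=.
by rewrite sE -[in RHS]nat1r mulrDl mul1r.
Qed.

(** Convolving parameters [r] and [r / m] gives [r / (m + 1)] and the factor
    [1 / sqrt (r (m + 1) / m)]; the factors telescope. For [r = n] and an [m]-fold power the
    constant is the inverse of the normalization [sqrt (m n^(m-1))] in [u_]. *)
Lemma star_pow_gb r s m : s%:num = r%:num / m.+1%:R ->
  star_pow (gb r 0) m.+1 = (sqrtQ R (m.+1%:R * r%:num ^+ m))^-1 *: gb s 0.
Proof.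
have r0 : 0 < r%:num by [].
rewrite /star_pow iteropS; elim: m s => [|m IH] s sE /=.
  rewrite expr0 mulr1 sqrtQ1 invr1 scale1r; apply: gb_eq => //.
  by rewrite sE divr1.
rewrite (IH (r%:num / m.+1%:R)%:pos) // starZr star_gb scalerA.
have m0 : 0 < m.+1%:R :> rat by rewrite ltr0n.
apply: scale_gb => //=.
- rewrite !subrr expr0n mul0r Qpi_exp0 mul1r -invfM -sqrtQM; last first.
    by rewrite mulr_ge0 ?exprn_ge0.
  congr ((sqrtQ R _)^-1); rewrite -[m.+2%:R]nat1r exprS.
  by field; rewrite gt_eqF.
- rewrite sE -[m.+2%:R]nat1r; field.
  by rewrite !nat1r !gt_eqF ?addr_gt0 ?mulr_gt0 ?ltr0n.
- by rewrite !mul0r ?addr0 ?mul0r.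
Qed.

(** So [u_] at [rho] stands for [e^(- pi rho x^2)]: the pointwise power multiplies the parameter by
    the numerator, the star power divides it by the denominator, and the normalization cancels. *)
Lemma u_gunit rho r : r%:num = rho -> u_ gunit rho = gb r 0.
Proof.
move=> rE; have rho0 : 0 < rho by rewrite -rE.
have : (`|numq rho| != 0)%N by rewrite absz_eq0 numq_eq0 gt_eqF.
have : (`|denq rho| != 0)%N by rewrite absz_eq0 denq_eq0.
have rhoE : rho = `|numq rho|%:R / `|denq rho|%:R.
  rewrite -[LHS]divq_num_den !natr_absz !ger0_norm // ?denq_ge0 // numq_ge0 ltW //.
rewrite /u_; case: `|numq rho|%N `|denq rho|%N rhoE => [|n] [|m] // rhoE _ _.
rewrite -[gunit]scale1r (@dot_pow_gb _ _ n.+1%:R%:pos) ?mulr1 // expr1n scale1r.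
rewrite (@star_pow_gb _ r) ?rE // scalerA divff ?scale1r //.
by rewrite sqrtQ_neq0 // mulr_gt0 ?exprn_gt0 ?ltr0n.
Qed.

Lemma sqrtQX c n : 0 <= c -> sqrtQ R c ^+ n = sqrtQ R (c ^+ n).
Proof.
move=> c0; elim: n => [|n IH]; first by rewrite !expr0 sqrtQ1.
by rewrite !exprS IH sqrtQM.
Qed.

Lemma gunit_relations x : gaussian_relations gunit x -> x = 0.
Proof.
case=> [[[al [al' [rho [rho' [r0 r0' ->]]]]]|[mu [mu' [rho [rho' [r0 r0' ->]]]]]]
    |[n [m [n0 m0 ->]]]]; apply/eqP; rewrite subr_eq0; apply/eqP.
- have h := ratC_neq0 (addr_gt0 r0 r0'); rewrite !ratCE in h.
  rewrite (@u_gunit _ (PosNum r0)) // (@u_gunit _ (PosNum r0')) //.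
  rewrite (@u_gunit _ ((PosNum r0)%:num * (PosNum r0')%:num /
    ((PosNum r0)%:num + (PosNum r0')%:num))%:pos) //.
  rewrite !hact_freq_gb !add0r star_gb; apply: scale_gb => //=.
    rewrite exp_piQE; congr (Qpi_exp R _ / _).
    rewrite imQE [imQ al']imQE -mulrBr exprMn imQ_sqr expr1n mulN1r.
    by rewrite expr2 [in RHS]expr2 !ratCE mulNr.
  by rewrite imQE [imQ al']imQE [RHS]imQE !ratCE; field.
- have h := ratC_neq0 (addr_gt0 r0 r0'); rewrite !ratCE in h.
  rewrite (@u_gunit _ (PosNum r0)) // (@u_gunit _ (PosNum r0')) //.
  rewrite (@u_gunit _ ((PosNum r0)%:num + (PosNum r0')%:num)%:pos) //.
  rewrite !hact_pos_gb dotZl dotZr !scalerA dot_gb; apply: scale_gb => //=.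
    rewrite exp_piQE -!Qpi_expD; congr (Qpi_exp R _).
    by rewrite /boxplus expr2 !ratCE; field.
  by rewrite !ratCE; field.
- case: n m n0 m0 => [|n] [|m] // _ _.
  have n0 : 0 < n.+1%:R :> rat by rewrite ltr0n.
  have m0 : 0 < m.+1%:R :> rat by rewrite ltr0n.
  rewrite (@star_pow_gb _ m.+1%:R^-1%:pos) ?div1r //.
  rewrite (@dot_pow_gb _ _ (n.+1%:R / m.+1%:R)%:pos) //.
  rewrite -[gunit]scale1r (@dot_pow_gb _ _ n.+1%:R%:pos) ?mulr1 // expr1n scale1r.
  rewrite (@star_pow_gb _ (n.+1%:R / m.+1%:R)%:pos) // scalerA; congr (_ *: _).
  rewrite exprVn sqrtQX; last by rewrite mulr_ge0 ?exprn_ge0.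
  have nz q : 0 < q -> sqrtQ R q != 0 by exact: sqrtQ_neq0.
  rewrite expr1n mulr1 /=.
  (* With the true exponents [n] and [m] this reads [m n^(m-1) = m^n (n^(m-1) / m^(n-1))]; the last
     factor is the radicand in the relation. *)
  have -> : m.+1%:R * n.+1%:R ^+ m =
      m.+1%:R ^+ n.+1 * (n.+1%:R ^+ m / m.+1%:R ^+ n) :> rat.
    by rewrite exprS; field; rewrite expf_neq0 // gt_eqF.
  rewrite [sqrtQ R (_ ^+ n.+1 * _)]sqrtQM ?exprn_ge0 // invfM mulrCA divff ?mulr1 //.
  by apply: nz; rewrite divr_gt0 ?exprn_gt0.
Qed.

End GaussianRelations.

(** * The morphism determined by a solution of the relations *)

Section Presentation.
Variables (R : realType) (B : twainType R) (v : B).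
Hypothesis v_rel : forall x, gaussian_relations v x -> x = 0.
Local Notation gb rho w := (<< ((rho, w) : gkey) >> : gmod R).
Local Notation F al := (hact (heis_freq R al)).
Local Notation P mu := (hact (heis_pos R mu)).
Local Notation J := (imQ 1).

Lemma complex_ratE (w : rat[i]) : w = (complex.Re w)%:C + J * (complex.Im w)%:C.
Proof.
by rewrite -imQE; case: w => a b; apply/eqP; rewrite eq_complex /= addr0 add0r !eqxx.
Qed.

Lemma hactZ h c (x : B) : hact h (c *: x) = c *: hact h x.
Proof. exact/linear_scale/hact_linear. Qed.

Lemma hact_freqD al be (x : B) : F al (F be x) = F (al + be) x.
Proof.
rewrite -hactM; congr (hact _ x); apply: heisP => /=; rewrite ?addr0 //.
by rewrite mulr0 [ratr 0]rmorph0 etau0 !mulr1.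
Qed.

Lemma hact_posD mu nu (x : B) : P mu (P nu x) = P (mu + nu) x.
Proof.
rewrite -hactM; congr (hact _ x); apply: heisP => /=; rewrite ?addr0 //.
by rewrite mul0r [ratr 0]rmorph0 etau0 !mulr1.
Qed.

Lemma hact_heis c mu al (x : B) : hact (Heis c mu al) x = TQ_Qpi c *: P mu (F al x).
Proof.
rewrite -hact_scalar -!hactM; congr (hact _ x); apply: heisP => /=.
- by rewrite !mul0r [ratr 0]rmorph0 etau0 !mulr1.
- by rewrite add0r addr0.
- by rewrite !add0r.
Qed.

Lemma hact_freq_pos al mu (x : B) :
  F al (P mu x) = Qpi_exp R (2 * imQ (al * mu)) *: P mu (F al x).
Proof.
rewrite -TQ_etauE -hact_heis -hactM; congr (hact _ x); apply: heisP => /=.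
- by rewrite !mul1r.
- by rewrite add0r.
- by rewrite addr0.
Qed.

Lemma hact_pos_freq al mu (x : B) :
  P mu (F al x) = Qpi_exp R (- (2 * imQ (al * mu))) *: F al (P mu x).
Proof.
by rewrite hact_freq_pos scalerA -Qpi_expD addNr Qpi_exp0 scale1r.
Qed.

Let star_u al al' rho rho' : 0 < rho -> 0 < rho' ->
  star (F al (u_ v rho)) (F al' (u_ v rho')) =
  (exp_piQ R (- ((al - al') ^+ 2 / (rho + rho'))) / sqrtQ R (rho + rho')) *:
  F ((al * rho' + al' * rho) / (rho + rho')) (u_ v (boxplus rho rho')).
Proof.
move=> r0 r0'; apply/eqP; rewrite -subr_eq0; apply/eqP/v_rel.
by left; left; exists al, al', rho, rho'.
Qed.

Let dot_u mu mu' rho rho' : 0 < rho -> 0 < rho' ->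
  dot (P mu (u_ v rho)) (P mu' (u_ v rho')) =
  exp_piQ R (- (boxplus rho rho' * (mu - mu') ^+ 2)) *:
  P ((mu * rho + mu' * rho') / (rho + rho')) (u_ v (rho + rho')).
Proof.
move=> r0 r0'; apply/eqP; rewrite -subr_eq0; apply/eqP/v_rel.
by left; right; exists mu, mu', rho, rho'.
Qed.

(** The scalar undoes the constant term of [exp (- pi rho (x - mu)^2)], where [mu] is the real part
    of [w] over [rho]. Modulation is outermost, as in [e_alpha g_(mu, rho)], so no phase appears. *)
Definition gauss_lift_key (k : gkey) : B :=
  Qpi_exp R (complex.Re k.2 ^+ 2 / k.1%:num)%:C *:
  F (complex.Im k.2) (P (complex.Re k.2 / k.1%:num) (u_ v k.1%:num)).

Definition gauss_lift : gmod R -> B := fglift gauss_lift_key.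

(** Reading the parts of [w] off an equation avoids computing them for compound keys. *)
Lemma gauss_lift_gb (r : {posnum rat}) w (X Y : rat) : w = X%:C + J * Y%:C ->
  gauss_lift (gb r w) = Qpi_exp R (X ^+ 2 / r%:num)%:C *:
    F Y (P (X / r%:num) (u_ v r%:num)).
Proof.
move=> ->; rewrite /gauss_lift fgliftU1 /gauss_lift_key /=.
have -> : X + (0 * Y - 1 * 0) = X by ring.
by have -> : 0 + (0 * 0 + 1 * Y) = Y by ring.
Qed.

Lemma gauss_lift_linear : linear gauss_lift.
Proof. exact: fglift_linear. Qed.

(** Modulations come out of either factor of [dot] by the twain axioms and commutativity; what
    remains is [dot_u] for two translates. *)
Lemma gauss_lift_dot : {morph gauss_lift : a b / dot a b}.
Proof.
apply: bilinear_ext => [b c a a'|a c b b'|b c a a'|a c b b'|[r w] [s z]].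
- by rewrite dot_linearl gauss_lift_linear.
- by rewrite dot_linearr gauss_lift_linear.
- by rewrite gauss_lift_linear dot_linearl.
- by rewrite gauss_lift_linear dot_linearr.
rewrite dot_gb /gdot /=.
move: (complex.Re w) (complex.Im w) (complex_ratE w) => X Y wE.
move: (complex.Re z) (complex.Im z) (complex_ratE z) => X' Y' zE.
rewrite (gauss_lift_gb _ wE) (gauss_lift_gb _ zE).
rewrite (@gauss_lift_gb _ _ (X + X') (Y + Y')); last first.
  by rewrite wE zE !ratCE; ring.
have dU := dot_u; move: (u_ v) dU => U dU.
rewrite dotZl dotZr scalerA -hact_freq_dot [dot _ (F _ _)]dotC.
rewrite -hact_freq_dot hact_freqD.
rewrite [dot _ (P _ (U r%:num))]dotC dU // !hactZ scalerA /=.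
have r0 : 0 < r%:num by []; have s0 : 0 < s%:num by [].
have h := ratC_neq0 (addr_gt0 r0 s0); have hr := ratC_neq0 r0; have hs := ratC_neq0 s0.
move: r%:num s%:num r0 s0 h hr hs => {wE zE}{}r {}s r0 s0 h hr hs.
congr (_ *: hact _ (hact (heis_pos R _) _)).
  rewrite exp_piQE -!Qpi_expD; congr (Qpi_exp R _).
  by rewrite /boxplus !expr2 !ratCE in h *; field; rewrite ?h ?hr ?hs.
by field; rewrite !gt_eqF ?addr_gt0.
Qed.

(** Here translations come out of the factors, so they are first commuted past the modulations,
    which creates phases; after [star_u] the order is restored. *)
Lemma gauss_lift_star : {morph gauss_lift : a b / star a b}.
Proof.
apply: bilinear_ext => [b c a a'|a c b b'|b c a a'|a c b b'|[r w] [s z]].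
- by rewrite star_linearl gauss_lift_linear.
- by rewrite star_linearr gauss_lift_linear.
- by rewrite gauss_lift_linear star_linearl.
- by rewrite gauss_lift_linear star_linearr.
rewrite star_gb /gstar (linear_scale _ _ gauss_lift_linear) /=.
move: (complex.Re w) (complex.Im w) (complex_ratE w) => X Y wE.
move: (complex.Re z) (complex.Im z) (complex_ratE z) => X' Y' zE.
have r0 : 0 < r%:num by []; have s0 : 0 < s%:num by [].
have h := ratC_neq0 (addr_gt0 r0 s0); have hr := ratC_neq0 r0; have hs := ratC_neq0 s0.
rewrite (gauss_lift_gb _ wE) (gauss_lift_gb _ zE).
rewrite (@gauss_lift_gb _ _ ((X * s%:num + X' * r%:num) / (r%:num + s%:num))
   ((Y * s%:num + Y' * r%:num) / (r%:num + s%:num))); last first.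
  by rewrite wE zE !ratCE in h *; field.
have sU := star_u; move: (u_ v) sU => U sU.
rewrite starZl starZr ![in RHS]hact_freq_pos starZl starZr -hact_pos_star.
rewrite [star _ (P _ _)]starC -hact_pos_star [star _ (F Y _)]starC sU //.
rewrite !hactZ hact_posD [in RHS]hact_pos_freq.
rewrite !scalerA wE zE /=.
move: r%:num s%:num r0 s0 h hr hs => {wE zE}{}r {}s r0 s0 h hr hs.
(* Under convolution the two centres add. *)
have box : (X * s + X' * r) / (r + s) / (r * s / (r + s)) = X / r + X' / s.
  by field; rewrite !gt_eqF ?addr_gt0.
rewrite box; congr (_ *: _).
set q := (sqrtQ R _)^-1; rewrite exp_piQE.
rewrite [LHS]mulrAC ![in RHS]mulrA [RHS]mulrAC -!Qpi_expD; congr (Qpi_exp R _ * q).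
(* [field] treats [J] as an indeterminate, so the square of [J] in the exponent of [gstar] is
   replaced first. *)
have JJ : J * J = -1 by rewrite -expr2 imQ_sqr expr1n.
have -> : X%:C + J * Y%:C - (X'%:C + J * Y'%:C) =
    (X%:C - X'%:C) + J * (Y%:C - Y'%:C) by ring.
rewrite sqrrD exprMn [J ^+ 2]JJ mulN1r.
by rewrite !(imQE (_ * _)) !expr2 !ratCE in h *; field; rewrite ?h ?hr ?hs.
Qed.

Lemma gauss_lift_hact h : {morph gauss_lift : a / hact h a}.
Proof.
apply: freeg_linear_ext => [c a b|c a b|[r w]].
- by rewrite hact_linear gauss_lift_linear.
- by rewrite gauss_lift_linear hact_linear.
rewrite hact_gb /gact (linear_scale _ _ gauss_lift_linear) /=.
move: (complex.Re w) (complex.Im w) (complex_ratE w) => X Y wE.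
case: h => c x xi /=.
rewrite (gauss_lift_gb _ wE) (@gauss_lift_gb _ _ (X + r%:num * x) (Y + xi)); last first.
  by rewrite wE [imQ xi]imQE !ratCE; ring.
move: (u_ v) => U.
rewrite hact_heis !hactZ !scalerA hact_freqD hact_pos_freq hact_posD scalerA.
have r0 : 0 < r%:num by []; have hr := ratC_neq0 r0.
have -> : (X + r%:num * x) / r%:num = x + X / r%:num.
  by field; rewrite gt_eqF.
rewrite [xi + Y]addrC; congr (_ *: _).
rewrite -[LHS]mulrA -[RHS]mulrA; congr (_ * _).
rewrite -!Qpi_expD; congr (Qpi_exp R _).
by rewrite wE [imQ xi]imQE (imQE (_ * _)) !expr2 !ratCE; field.
Qed.

Lemma gauss_lift_morphism : twain_morphism gauss_lift.
Proof.
split; [exact: gauss_lift_linear|exact: gauss_lift_star|exact: gauss_lift_dot|].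
exact: gauss_lift_hact.
Qed.

End Presentation.

Lemma twain_quot_lift (R : realType) (A B : twainType R) (I : twainIdeal A)
    (f : A -> B) : twain_morphism f -> (forall a, a \in I -> f a = 0) ->
  exists2 phi : twain_quot I -> B,
    twain_morphism phi & forall a, phi (twain_proj I a) = f a.
Proof.
move=> fm fI; have pK (q : twain_quot I) : twain_proj I (repr q) = q by exact: reprK.
have [pl ps pd ph] := twain_proj_morphism I.
pose phi (q : twain_quot I) := f (repr q).
have phiE a : phi (twain_proj I a) = f a.
  apply/eqP; rewrite -subr_eq0 -(twain_morphismB fm); apply/eqP/fI.
  exact/twain_projP/pK.
case: (fm) => fl fs fd fh; exists phi => //; split.
- by move=> c p q; rewrite -(pK p) -(pK q) -pl !phiE fl.
- by move=> p q; rewrite -(pK p) -(pK q) -ps !phiE fs.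
- by move=> p q; rewrite -(pK p) -(pK q) -pd !phiE fd.
- by move=> h q; rewrite -(pK q) -ph !phiE fh.
Qed.

Lemma twain_morphism_comp (R : realType) (A B C : twainType R)
    (f : A -> B) (g : B -> C) :
  twain_morphism f -> twain_morphism g -> twain_morphism (g \o f).
Proof.
move=> [fl fs fd fh] [gl gs gd gh]; split=> [c a b|a b|a b|h a] /=.
- by rewrite fl gl.
- by rewrite fs gs.
- by rewrite fd gd.
- by rewrite fh gh.
Qed.

Lemma u_1 (R : realType) (A : twainType R) (v : A) : u_ v 1 = v.
Proof. by rewrite /u_ /= mulr1 sqrtQ1 scale1r. Qed.

Lemma presentation_bijective (R : realType) (T : twainType R) (u : T) :
  is_free_twain u ->
  exists phi : twain_quot (twain_gen (gaussian_relations u)) -> gmod R,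
    [/\ twain_morphism phi, bijective phi
      & phi (twain_proj (twain_gen (gaussian_relations u)) u) = gunit R].
Proof.
move=> Tfree; set I := twain_gen _.
have [f [[fm fu] _]] := Tfree (gmod R) (gunit R).
have frel s : gaussian_relations u s -> f s = 0.
  move=> us; apply: gunit_relations.
  by rewrite -fu twain_morphism_relations //; exists s.
have [phi phim phiE] : exists2 phi : twain_quot I -> gmod R,
    twain_morphism phi & forall a, phi (twain_proj I a) = f a.
  by apply: twain_quot_lift => // a; exact: twain_gen_ker.
pose v := twain_proj I u.
have pm := twain_proj_morphism I.
have vrel x : gaussian_relations v x -> x = 0.
  rewrite twain_morphism_relations // => -[r ur <-].
  rewrite -(twain_morphism0 pm); apply/twain_projP; rewrite subr0.
  exact: twain_gen_sub.
have psim := gauss_lift_morphism vrel.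
have psi1 : gauss_lift v (gunit R) = v.
  rewrite (@gauss_lift_gb _ _ _ _ _ 0 0); last first.
    by apply/eqP; rewrite eq_complex /=; apply/andP; split; apply/eqP; ring.
  by rewrite u_1 !mul0r Qpi_exp0 scale1r !hact_scalar !TQ_Qpi1 !scale1r.
exists phi; split=> //; last by rewrite phiE.
exists (gauss_lift v) => [q|m].
- have [g [_ guniq]] := Tfree _ v.
  (* Both are morphisms from [T] sending [u] to [v], hence equal by freeness. *)
  have E : gauss_lift v \o f = twain_proj I.
    rewrite -(guniq (gauss_lift v \o f)); last first.
      by split; [exact: twain_morphism_comp|rewrite /= fu psi1].
    by apply: guniq.
  rewrite -[q in RHS](reprK q) -[RHS]/(twain_proj I (repr q)) -E /=; congr gauss_lift.
  by rewrite -phiE; congr phi; exact/esym/reprK.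
- move: m; apply: freeg_linear_ext => [c a b|c a b|[r w]] //.
    by rewrite (gauss_lift_linear v) (twain_morphism_linear phim).
  rewrite (gauss_lift_gb _ _ (complex_ratE w)).
  rewrite (twain_morphism_scale phim) !(twain_morphism_hact phim).
  rewrite (twain_morphism_u phim) phiE fu (@u_gunit _ _ r) //.
  rewrite hact_pos_gb hactZ hact_freq_gb scalerA -[RHS]scale1r.
  (* The constant from translating a centred Gaussian is inverse to the scalar in
     [gauss_lift_key]. *)
  apply: scale_gb => //.
    rewrite -Qpi_expD -[RHS]Qpi_exp0; congr Qpi_exp.
    rewrite mulr0 add0r -rmorphM -rmorphN -rmorphD /= -[RHS]/(0%:C); congr (_%:C).
    by field; rewrite gt_eqF.
  by rewrite add0r [RHS]complex_ratE -imQE mulrCA divff ?mulr1.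
Qed.

(** * Linear independence of Gaussians *)

Section Characters.
Variable R : realType.

(* Subtracting [etau (a t)] times the relation at [x] from the relation at
   [t + x] eliminates the character of frequency [a]. *)
Lemma etau_free (s : seq rat) (c : rat -> R[i]) : uniq s ->
    (forall x : R, \sum_(al <- s) c al * etau (ratr al * x) = 0) ->
  {in s, forall al, c al = 0}.
Proof.
elim: s c => [//|a l IH] c /= /andP[al ul] c0.
have cl : {in l, forall be, c be = 0}.
  move=> be bel; have ab : ratr be - ratr a != 0 :> R.
    rewrite subr_eq0 (inj_eq (fmorph_inj _)); apply: contraNneq al => <-.
    exact: bel.
  (* This [t] makes [(be - a) t = 1/2], so that the factor of [c be] in [c' be] is [-2 etau (a t)],
     which is not zero. *)
  pose t : R := (2 * (ratr be - ratr a))^-1.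
  pose c' ga := c ga * (etau (ratr ga * t) - etau (ratr a * t)).
  have c'0 x : \sum_(ga <- l) c' ga * etau (ratr ga * x) = 0.
    have := c0 (t + x); have := c0 x; rewrite !big_cons => h1 h2.
    transitivity (c a * etau (ratr a * (t + x)) +
        \sum_(ga <- l) c ga * etau (ratr ga * (t + x)) -
      etau (ratr a * t) * (c a * etau (ratr a * x) +
        \sum_(ga <- l) c ga * etau (ratr ga * x))).
      rewrite [etau _ * (c a * _ + _)]mulrDr mulr_sumr opprD addrACA -sumrB.
      rewrite [X in X + _](_ : _ = 0) ?add0r; last by rewrite mulrDr etauD; ring.
      by apply: eq_bigr => ga _; rewrite mulrDr etauD /c'; ring.
    by rewrite h1 h2 mulr0 subr0.
  have /eqP := IH c' ul c'0 be bel.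
  rewrite /c' mulf_eq0 => /orP[/eqP //|].
  have -> : ratr be * t = 2^-1 + ratr a * t by rewrite /t; field.
  rewrite etauD etau_half mulN1r -opprD oppr_eq0 -mulr2n -mulr_natr mulf_eq0.
  by rewrite (negbTE (etau_neq0 _)) pnatr_eq0.
move=> be; rewrite inE => /orP[/eqP ->|/cl //].
have := c0 0; rewrite big_cons big_seq big1 => [|ga /cl ->]; last by rewrite mul0r.
by rewrite addr0 mulr0 etau0 mulr1.
Qed.

End Characters.

(** * Growth of Gaussians and their independence *)

Section ComplexGaussians.
Variable R : realType.
Implicit Types (r x : R) (z : R[i]).

Definition cgauss r z x : R[i] := cexp (pi%:C * (2 * z * x%:C - r%:C * x%:C ^+ 2)).

Lemma cgaussE r a b x : cgauss r (a +i* b) x =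
  (gexp r a x)%:C * etau (b * x).
Proof.
rewrite /cgauss /gexp -cexpR /etau -cexpD; congr cexp.
apply/eqP; rewrite eq_complex /= expr2 /=; move: (pi : R) => p.
by apply/andP; split; apply/eqP; ring.
Qed.

Definition gfun (k : gkey) : R -> R[i] := cgauss (ratr k.1%:num) (cratr R k.2).

Lemma gfunE k x : gfun k x =
  (gexp (ratr k.1%:num) (ratr (complex.Re k.2)) x)%:C *
    etau (ratr (complex.Im k.2) * x).
Proof. by rewrite /gfun; case: k => r [a b] /=; rewrite cgaussE. Qed.

Lemma etau_int (m : int) : etau (m%:~R : R) = 1.
Proof.
case: (intP m) => [|n|n]; [exact: etau0|exact: etau_nat|].
by rewrite mulrNz etauN (etau_nat R n.+1) invr1.
Qed.

Lemma etau_denq (b : rat) (n : nat) : (`|denq b| %| n)%N ->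
  etau (ratr b * n%:R : R) = 1.
Proof.
move=> /dvdnP[q ->]; rewrite -(etau_int (numq b * q%:Z)); congr etau.
rewrite natrM natr_absz gtr0_norm ?denq_gt0 // intrM /ratr.
by field; rewrite intr_eq0 denq_neq0.
Qed.

Lemma cvg_gexp_lin a (u : R^nat) : a < 0 -> (forall n, n.+1%:R <= u n) ->
  gexp 0 a (u n) @[n --> \oo] --> 0.
Proof.
move=> a0 un; have pi0 := pi_gt0 R; pose M := (- (2 * pi * a))^-1.
have M0 : 0 < - (2 * pi * a) by rewrite oppr_gt0 nmulr_llt0 ?mulr_gt0.
apply: (@squeeze_cvgr _ _ _ _ (cst 0) (fun n => M * harmonic n)).
- apply: nearW => n; rewrite ltW ?gexp_gt0 //= /harmonic /M -invfM.
  have v0 : 0 < - (2 * pi * a) * n.+1%:R by rewrite mulr_gt0.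
  have -> : gexp 0 a (u n) = (expR (- (2 * pi * a) * u n))^-1.
    by rewrite -expRN; congr expR; move: (pi : R) => p; ring.
  rewrite lef_pV2 ?posrE ?expR_gt0 //; apply: (@le_trans _ _ (- (2 * pi * a) * u n)).
    by rewrite ler_pM2l.
  by apply: le_trans (expR_ge1Dx _); rewrite lerDr.
- exact: cvg_cst.
- by rewrite -[X in _ --> X](mulr0 M); apply: cvgMr; exact: cvg_harmonic.
Qed.

(** Comparison of moduli at [+oo]: a smaller [rho] wins, then a larger real part of [w]. Keys
    differing only in the imaginary part tie. *)
Definition dominates (k l : gkey) : bool :=
  (k.1%:num < l.1%:num) ||
  ((k.1%:num == l.1%:num) && (complex.Re l.2 <= complex.Re k.2)).

Lemma dominates_refl : reflexive dominates.
Proof. by move=> k; rewrite /dominates eqxx lexx orbT. Qed.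

Lemma dominates_trans : transitive dominates.
Proof.
move=> l k m; rewrite /dominates => /orP[kl|/andP[/eqP -> kl]].
  move=> /orP[lm|/andP[/eqP <- lm]]; first by rewrite (lt_trans kl).
  by rewrite kl.
move=> /orP[lm|/andP[/eqP <- lm]]; first by rewrite lm.
by rewrite eqxx (le_trans lm) ?orbT.
Qed.
Lemma dominates_total : total dominates.
Proof. by move=> k l; rewrite /dominates; case: ltgtP => //= _; exact: le_total. Qed.

Lemma dominant_key (s : seq gkey) : s != [::] ->
  exists2 k, k \in s & {in s, forall l, dominates k l}.
Proof.
case: s => // a l _; elim: l a => [|b l IH] a.
  by exists a => [|k]; rewrite mem_seq1 // => /eqP ->; exact: dominates_refl.
have [k kbl kdom] := IH b; case/orP: (dominates_total a k) => h.
  exists a => [|m]; first exact: mem_head.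
  rewrite inE => /orP[/eqP ->|/kdom]; first exact: dominates_refl.
  exact: dominates_trans.
exists k => [|m]; first by rewrite inE kbl orbT.
by rewrite inE => /orP[/eqP ->|/kdom].
Qed.

Lemma gexpM s s' a a' x : gexp s a x = gexp s' a' x * gexp (s - s') (a - a') x :> R.
Proof. by rewrite /gexp -expRD; congr expR; move: (pi : R) => p; ring. Qed.

Lemma cvg_sum0 (I : eqType) (s : seq I) (P : pred I) (e : I -> R) (t : I -> R^nat) :
    (forall k, k \in s -> P k -> t k j @[j --> \oo] --> 0) ->
  \sum_(k <- s | P k) e k * t k j @[j --> \oo] --> 0.
Proof.
elim: s => [|k s IH] t0; first by under eq_fun do rewrite big_nil; exact: cvg_cst.
have {}IH := IH (fun l ls => t0 l (mem_behead (s := k :: s) ls)).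
case Pk: (P k); under eq_fun do rewrite big_cons Pk; last exact: IH.
have h : e k * t k j @[j --> \oo] --> e k * 0.
  by apply: cvgMr; apply: t0; rewrite ?mem_head.
by have h2 := cvgD h IH; rewrite mulr0 addr0 in h2; exact: h2.
Qed.

(* Along [x + j N], with [N] a common denominator of the frequencies, the
   oscillating factors are constant, so that after division by the dominant
   Gaussian the other terms tend to 0. *)
Lemma dominant_part (s : seq gkey) (c : gkey -> R[i]) k0 :
    {in s, forall l, dominates k0 l} ->
    (forall x, \sum_(k <- s) c k * gfun k x = 0) ->
  forall x, \sum_(k <- s | (k.1 == k0.1) && (complex.Re k.2 == complex.Re k0.2))
    c k * etau (ratr (complex.Im k.2) * x) = 0.
Proof.
move=> k0dom c0 x.
pose tp := [pred k : gkey | (k.1 == k0.1) && (complex.Re k.2 == complex.Re k0.2)].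
pose N := (\prod_(k <- s) `|denq (complex.Im k.2)|)%N.
have N0 : (0 < N)%N.
  rewrite /N; elim: s {k0dom c0} N => [|k s IH] N; first by rewrite big_nil.
  by rewrite big_cons muln_gt0 absz_gt0 denq_neq0 IH.
have dN k : k \in s -> (`|denq (complex.Im k.2)| %| N)%N.
  by move=> ks; rewrite /N (big_rem k) //= dvdn_mulr.
(* The bound of [|x|] is added to the index so that [y j] is at least [j + 1] even for negative
   [x]. *)
pose y (j : nat) : R := x + (j.+1 + Num.bound `|x|)%:R * N%:R.
have yj j : j.+1%:R <= y j.
  have xb : - (Num.bound `|x|)%:R <= x.
    by have /ltW := archi_boundP (normr_ge0 x); rewrite ler_norml => /andP[].
  apply: (@le_trans _ _ (x + (j.+1 + Num.bound `|x|)%:R)).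
    by rewrite natrD -[leLHS]add0r addrCA [leRHS]addrC; lra.
  by rewrite lerD2l -natrM ler_nat leq_pmulr.
pose a (k : gkey) : R := ratr (complex.Re k.2) - ratr (complex.Re k0.2).
pose r (k : gkey) : R := ratr k.1%:num - ratr k0.1%:num.
pose t (k : gkey) j : R := gexp (r k) (a k) (y j).
have t0 k : k \in s -> ~~ tp k -> t k j @[j --> \oo] --> 0.
  move=> ks ntk; have := k0dom k ks; rewrite /dominates => /orP[lt|/andP[/eqP e le]].
    apply: cvg_gexp => [|n]; first by rewrite /r subr_gt0 ltr_rat.
    by rewrite ger0_norm // (le_trans _ (yj n)).
  rewrite /t /r e subrr; apply: cvg_gexp_lin => //.
  rewrite /a subr_lt0 ltr_rat lt_neqAle le andbT.
  by apply: contra ntk => ee; rewrite /tp /= ee andbT -(inj_eq val_inj) /= e.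
pose d k : R[i] := c k * etau (ratr (complex.Im k.2) * x).
pose A := \sum_(k <- s | tp k) d k; rewrite -[LHS]/A.
have rel j : A + \sum_(k <- s | ~~ tp k) d k * (t k j)%:C = 0.
  pose G := gexp (ratr k0.1%:num) (ratr (complex.Re k0.2)) (y j) : R.
  have G0 : G%:C != 0 :> R[i] by rewrite eq_complex /= gt_eqF ?gexp_gt0.
  apply: (mulfI G0); rewrite mulr0 -[RHS](c0 (y j)) [RHS](bigID tp) /=.
  have E k : k \in s -> c k * gfun k (y j) = G%:C * (d k * (t k j)%:C).
    move=> ks; rewrite gfunE (gexpM _ (ratr k0.1%:num) _ (ratr (complex.Re k0.2))).
    rewrite rmorphM /= /d -/(a k) -/(r k) -/(t k j) -/G.
    have -> : etau (ratr (complex.Im k.2) * y j) = etau (ratr (complex.Im k.2) * x).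
      by rewrite /y -natrM mulrDr etauD etau_denq ?mulr1 // dvdn_mull // dN.
    by ring.
  rewrite /A mulrDr !mulr_sumr; congr (_ + _); rewrite big_seq_cond [RHS]big_seq_cond;
    apply: eq_bigr => k /andP[ks tk]; rewrite E //.
  congr (_ * _); rewrite /t /r /a; case/andP: tk => /eqP -> /eqP ->.
  by rewrite !subrr /gexp !mulr0 !mul0r subrr mulr0 expR0 mulr1.
clearbody A.
(* [p] is the real or the imaginary part, so that limits are taken in [R]. *)
have lim0 (p : R[i] -> R) : {morph p : z w / z + w} ->
    (forall z (q : R), p (z * q%:C) = p z * q) -> p A = 0.
  move=> pD pq; have p0 : p 0 = 0 by rewrite -[0 in LHS](mulr0 (0 : R[i])) pq mulr0.
  have h j : p A = - \sum_(k <- s | ~~ tp k) p (d k) * t k j.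
    apply/eqP; rewrite -addr_eq0 -[X in _ == X]p0 -(rel j) pD.
    rewrite (big_morph p pD p0); apply/eqP; congr (_ + _).
    by apply: eq_bigr => k _; rewrite pq.
  have h1 : \sum_(k <- s | ~~ tp k) p (d k) * t k j @[j --> \oo] --> 0.
    by apply: cvg_sum0 => k; exact: t0.
  have h2 : \sum_(k <- s | ~~ tp k) p (d k) * t k j @[j --> \oo] --> - p A.
    by under eq_fun do rewrite -[\sum_(_ <- _ | _) _]opprK -h; exact: cvg_cst.
  by apply: oppr_inj; rewrite oppr0; exact: (cvg_unique _ h2 h1).
apply/eqP; rewrite eq_complex /=; apply/andP; split; apply/eqP.
- by apply: (lim0 (@complex.Re R)) => [[? ?] [? ?]|[a1 b1] q] //=; ring.
- by apply: (lim0 (@complex.Im R)) => [[? ?] [? ?]|[a1 b1] q] //=; ring.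
Qed.

(** Keys tied with a dominant one are determined by their frequencies, so [dominant_part] and
    [etau_free] annihilate their coefficients; the shorter list without them is handled by
    induction. *)
Lemma gfun_free (s : seq gkey) (c : gkey -> R[i]) : uniq s ->
    (forall x, \sum_(k <- s) c k * gfun k x = 0) ->
  {in s, forall k, c k = 0}.
Proof.
have [n] := ubnP (size s); elim: n s => // n IH s sn us c0.
have [->//|/dominant_key[k0 k0s k0dom]] := eqVneq s [::].
have top0 := dominant_part k0dom c0.
pose tp := [pred k : gkey | (k.1 == k0.1) && (complex.Re k.2 == complex.Re k0.2)].
have cl : {in s, forall k, tp k -> c k = 0}.
  pose mk al : gkey := (k0.1, complex.Re k0.2 +i* al).
  have mkK k : tp k -> mk (complex.Im k.2) = k.
    by case: k => r [a b] /= /andP[/eqP -> /eqP ->].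
  have : {in map (fun k : gkey => complex.Im k.2) [seq k <- s | tp k],
      forall al, (c \o mk) al = 0}.
    apply: (@etau_free R) => [|x].
      rewrite map_inj_in_uniq ?filter_uniq // => k l.
      by rewrite !mem_filter => /andP[tk _] /andP[tl _] kl; rewrite -(mkK k) // kl mkK.
    rewrite big_map big_filter -[RHS](top0 x).
    by apply: eq_bigr => l tl; rewrite /= mkK.
  move=> cmk k ks tk; rewrite -(mkK _ tk); apply: cmk.
  by apply/mapP; exists k; rewrite // mem_filter tk.
move=> k ks; case: (boolP (tp k)) => [|ntk]; first exact: cl.
apply: (IH [seq k <- s | predC tp k]).
- rewrite (leq_trans _ (ltnSE sn)) // size_filter -(count_predC tp s).
  rewrite -[ltnLHS]add0n ltn_add2r.
  by rewrite -has_count; apply/hasP; exists k0; rewrite //= !eqxx.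
- by rewrite filter_uniq.
- move=> x; rewrite big_filter -[RHS](c0 x) [RHS](bigID tp) /=.
  rewrite [X in _ = X + _]big_seq_cond [X in _ = X + _]big1 ?add0r //.
  by move=> l /andP[ls tl]; rewrite cl ?mul0r.
- by rewrite mem_filter ks andbT.
Qed.

End ComplexGaussians.

(** * Formal Gaussians as functions *)

Section Convolution.
Variable R : realType.
Local Notation mu := (@lebesgue_measure R).
Implicit Types (h : R -> R[i]).

Definition cintegrable h := mu.-integrable setT (EFin \o (fun y => complex.Re (h y))) /\
  mu.-integrable setT (EFin \o (fun y => complex.Im (h y))).

Definition cintegral h : R[i] :=
  (\int[mu]_y complex.Re (h y)) +i* (\int[mu]_y complex.Im (h y)).

Let intL a b (f g : R -> R) : mu.-integrable setT (EFin \o f) ->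
  mu.-integrable setT (EFin \o g) ->
  mu.-integrable setT (EFin \o (fun y => a * f y + b * g y)).
Proof.
by move=> fi gi; exact: (integrableD _ (integrableZl _ a fi) (integrableZl _ b gi)).
Qed.

Let RintL a b (f g : R -> R) : mu.-integrable setT (EFin \o f) ->
  mu.-integrable setT (EFin \o g) ->
  \int[mu]_y (a * f y + b * g y) = a * \int[mu]_y f y + b * \int[mu]_y g y.
Proof.
move=> fi gi; rewrite RintegralD //; last 2 first.
- exact: (integrableZl _ a fi).
- exact: (integrableZl _ b gi).
by rewrite !RintegralZl.
Qed.

Lemma cintegralL c h1 h2 : cintegrable h1 -> cintegrable h2 ->
  cintegrable (fun y => c * h1 y + h2 y) /\
  cintegral (fun y => c * h1 y + h2 y) = c * cintegral h1 + cintegral h2.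
Proof.
case: c => a b [r1 i1] [r2 i2].
have i12 := intL a b r1 i1; have i12' := intL a (- b) r1 i1.
have i34 := intL b a r1 i1.
have RE : (fun y => complex.Re ((a +i* b) * h1 y + h2 y)) =
    (fun y => 1 * (a * complex.Re (h1 y) + (- b) * complex.Im (h1 y)) +
      1 * complex.Re (h2 y)).
  by apply/funext => y; case: (h1 y) (h2 y) => ? ? [? ?] /=; ring.
have IE : (fun y => complex.Im ((a +i* b) * h1 y + h2 y)) =
    (fun y => 1 * (b * complex.Re (h1 y) + a * complex.Im (h1 y)) +
      1 * complex.Im (h2 y)).
  by apply/funext => y; case: (h1 y) (h2 y) => ? ? [? ?] /=; ring.
rewrite /cintegrable /cintegral RE IE.
split; first by split; exact: intL.
rewrite !RintL //; try exact: intL.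
apply/eqP; rewrite eq_complex /=; apply/andP; split; apply/eqP; ring.
Qed.

Lemma cintegral0 : cintegrable (fun=> 0) /\ cintegral (fun=> 0) = 0.
Proof.
split; first by split; exact: integrable0.
by rewrite /cintegral /= !Rintegral_cst // mul0r.
Qed.

Lemma cintegralZ c h : cintegrable h ->
  cintegrable (fun y => c * h y) /\ cintegral (fun y => c * h y) = c * cintegral h.
Proof.
move=> hi; have [] := cintegralL c hi cintegral0.1.
rewrite cintegral0.2 addr0.
rewrite (_ : (fun y => c * h y + 0) = fun y => c * h y) //.
by apply/funext => y; rewrite addr0.
Qed.

Lemma cintegral_cgauss s z : 0 < s -> cintegrable (cgauss s z) /\
  cintegral (cgauss s z) = (Num.sqrt s)^-1%:C * cexp (pi%:C * (z ^+ 2 / s%:C)).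
Proof.
case: z => a b s0.
have RE : (fun y => complex.Re (cgauss s (a +i* b) y)) =
    (fun y => gexp s a y * cos (2 * pi * b * y + 0)).
  apply/funext => y; rewrite cgaussE etauE /= mul0r subr0 addr0.
  by rewrite [_ * (b * y)]mulrA.
have IE : (fun y => complex.Im (cgauss s (a +i* b) y)) =
    (fun y => gexp s a y * sin (2 * pi * b * y + 0)).
  apply/funext => y; rewrite cgaussE etauE /= mul0r addr0 addr0.
  by rewrite [_ * (b * y)]mulrA.
rewrite /cintegrable /cintegral RE IE; split.
  by split; [exact: integrable_gexp_cos|exact: integrable_gexp_sin].
rewrite -gauss_cos_shift -/(gauss_cos s a b 0) !gauss_cosE //.
have -> : pi%:C * ((a +i* b) ^+ 2 / s%:C) =
    (pi * ((a ^+ 2 - b ^+ 2) / s)) +i* (2 * pi * (a * b / s)).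
  move: (pi : R) => p; have -> : (a +i* b) ^+ 2 = (a ^+ 2 - b ^+ 2) +i* (2 * a * b).
    by apply/eqP; rewrite eq_complex /=; apply/andP; split; apply/eqP; ring.
  rewrite -fmorphV /=.
  by apply/eqP; rewrite eq_complex /=; apply/andP; split; apply/eqP; ring.
rewrite /cexp addr0 add0r.
have -> : cos (2 * pi * (a * b / s) - pi / 2) = sin (2 * pi * (a * b / s)).
  by rewrite cosB cos_pihalf sin_pihalf mulr0 add0r mulr1.
move: (expR _) (cos _) (sin _) => e c d.
by apply/eqP; rewrite eq_complex /=; apply/andP; split; apply/eqP; ring.
Qed.

(** The factor free of [y] is split off, leaving a single Gaussian whose linear coefficient depends
    on [x]. *)
Lemma cgaussM r r' z z' (x y : R) : cgauss r z y * cgauss r' z' (x - y) =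
  cgauss r' z' x * cgauss (r + r') (z - z' + r'%:C * x%:C) y.
Proof.
rewrite /cgauss -!cexpD; congr cexp.
rewrite (rmorphB (real_complex R) x y) (rmorphD (real_complex R) r r') /=.
move: (pi%:C : R[i]) => p; ring.
Qed.

Lemma convolution_cgauss r r' z z' x : 0 < r -> 0 < r' ->
  cintegrable (fun y => cgauss r z y * cgauss r' z' (x - y)) /\
  convolution (cgauss r z) (cgauss r' z') x =
    cexp (pi%:C * ((z - z') ^+ 2 / (r + r')%:C)) / (Num.sqrt (r + r'))%:C *
    cgauss (r * r' / (r + r')) ((z * r'%:C + z' * r%:C) / (r + r')%:C) x.
Proof.
move=> r0 r0'; have s0 := addr_gt0 r0 r0'.
rewrite /convolution -/(cintegral (fun y => cgauss r z y * cgauss r' z' (x - y))).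
rewrite (_ : (fun y => _ * _) = (fun y =>
    cgauss r' z' x * cgauss (r + r') (z - z' + r'%:C * x%:C) y)); last first.
  by apply/funext => y; exact: cgaussM.
have [i1 e1] := cintegral_cgauss (z - z' + r'%:C * x%:C) s0.
have [i2 ->] := cintegralZ (cgauss r' z' x) i1; split=> //.
rewrite e1 fmorphV /= [RHS]mulrAC mulrCA [RHS]mulrC; congr (_ * _).
rewrite /cgauss -!cexpD; congr cexp.
have nz : (r + r')%:C != 0 :> R[i] by rewrite eq_complex /= gt_eqF.
rewrite !(rmorphM (real_complex R)) fmorphV /= in nz *.
rewrite (rmorphD (real_complex R) r r') /= in nz *.
move: (pi%:C : R[i]) => p; by field.
Qed.

End Convolution.

(** * Evaluation of formal Gaussians and the Gaussian closure *)

Section Evaluation.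
Variable R : realType.
Local Notation gb rho w := (<< ((rho, w) : gkey) >> : gmod R).
Implicit Types (a b m : gmod R) (c : Qpi R).

(** A copy of the complex numbers that carries scalars restricted to Q^pi, so that [fglift]
    applies. *)
Definition complex_over_Qpi := R[i].
HB.instance Definition _ := GRing.Zmodule.on complex_over_Qpi.

Definition Qpi_scale c (z : complex_over_Qpi) : complex_over_Qpi := Qpi_val c * z.

Fact Qpi_scaleA c d z : Qpi_scale c (Qpi_scale d z) = Qpi_scale (c * d) z.
Proof. exact: mulrA. Qed.
Fact Qpi_scale1 : left_id 1 Qpi_scale.
Proof. by move=> z; exact: mul1r. Qed.
Fact Qpi_scaleDr : right_distributive Qpi_scale +%R.
Proof. by move=> c y z; exact: mulrDr. Qed.
Fact Qpi_scaleDl z : {morph Qpi_scale^~ z : c d / c + d}.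
Proof. by move=> c d; exact: mulrDl. Qed.
HB.instance Definition _ := GRing.Zmodule_isLmodule.Build (Qpi R) complex_over_Qpi
  Qpi_scaleA Qpi_scale1 Qpi_scaleDr Qpi_scaleDl.

Definition gev m (x : R) : R[i] :=
  fglift (fun k => gfun k x : complex_over_Qpi) m.

Lemma gev_linear c a b x : gev (c *: a + b) x = Qpi_val c * gev a x + gev b x.
Proof. exact: (fglift_linear (fun k => gfun k x : complex_over_Qpi)). Qed.

Lemma gev0 x : gev 0 x = 0.
Proof. exact: (linear_at0 (fglift_linear (fun k => gfun k x : complex_over_Qpi))). Qed.

Lemma gevZ c a x : gev (c *: a) x = Qpi_val c * gev a x.
Proof. by rewrite -[c *: a]addr0 gev_linear gev0 addr0. Qed.

Lemma gevU k x : gev << k >> x = gfun k x.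
Proof. exact: (fgliftU1 (fun k => gfun k x : complex_over_Qpi)). Qed.

Lemma gev_sum (I : Type) (s : seq I) (f : I -> gmod R) x :
  gev (\sum_(i <- s) f i) x = \sum_(i <- s) gev (f i) x.
Proof.
elim: s => [|i s IH]; first by rewrite !big_nil gev0.
by rewrite !big_cons -[f i]scale1r gev_linear IH gevZ.
Qed.

Lemma gevE m x : gev m x = \sum_(k <- dom m) Qpi_val (coeff k m) * gfun k x.
Proof.
rewrite -{1}[m]freeg_sumE gev_sum; apply: eq_bigr => k _.
by rewrite -[in LHS](mulr1 (coeff k m)) -freegZU gevZ gevU.
Qed.

(** [gfun_free], which allows arbitrary complex coefficients, is applied to the support of [a - b],
    where no coefficient can vanish. *)
Lemma gev_inj : injective gev.
Proof.
move=> a b ab; apply/eqP; rewrite -subr_eq0 -dom_eq0.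
have c0 : {in dom (a - b), forall k, Qpi_val (coeff k (a - b)) = 0}.
  apply: gfun_free => [|x]; first exact: uniq_dom.
  rewrite -gevE -[a - b]addrC -scaleN1r gev_linear ab.
  by rewrite [Qpi_val _]/(- 1) mulN1r addNr.
case E : (dom (a - b)) => [//|k s]; have kd : k \in dom (a - b) by rewrite E mem_head.
have /eqP := c0 k kd; rewrite -[0]/(Qpi_val (0 : Qpi R)) (inj_eq (@Qpi_val_inj R)).
by move: kd; rewrite mem_dom => /negbTE ->.
Qed.

Lemma gfun_closure (rho : {posnum rat}) (al m : rat) x :
  e_ al x * g_ m rho%:num x = Qpi_val (Qpi_exp R (- (rho%:num * m ^+ 2))%:C) *
    gfun (rho, (rho%:num * m) +i* al) x.
Proof.
rewrite gfunE -exp_piQE /e_ /g_ mulrC mulrA; congr (_ * _) => /=.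
rewrite -rmorphM /= -expRD /gexp; congr ((expR _)%:C).
rewrite expr2 rmorphN !rmorphM /=.
by move: (pi : R) (ratr m : R) (ratr _ : R) => p m' r'; ring.
Qed.

Lemma gev_range : range gev = @gaussian_closure R.
Proof.
apply/seteqP; split=> [_ [m _ <-]|s [n [c [al [mu [rho [rho0 ->]]]]]]].
  pose k (i : 'I_(size (dom m))) := tnth (in_tuple (dom m)) i.
  exists (size (dom m)), (fun i => coeff (k i) m *
      Qpi_exp R (complex.Re (k i).2 ^+ 2 / (k i).1%:num)%:C),
    (fun i => complex.Im (k i).2), (fun i => complex.Re (k i).2 / (k i).1%:num),
    (fun i => (k i).1%:num); split=> //.
  apply/funext => x; rewrite gevE big_tnth; apply: eq_bigr => i _.
  rewrite -/(k i) gfun_closure Qpi_valM -mulrA; congr (_ * _).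
  case: (k i) => r [a b]; rewrite [RHS]mulrA -Qpi_valM -Qpi_expD.
  rewrite -ratCD.
  have -> : complex.Re (a +i* b) ^+ 2 / r%:num +
      - (r%:num * (complex.Re (a +i* b) / r%:num) ^+ 2) = 0.
    by rewrite /=; field; rewrite gt_eqF.
  rewrite (rmorph0 (real_complex rat)) Qpi_exp0 mul1r.
  have -> : r%:num * (complex.Re (a +i* b) / r%:num) = a.
    by rewrite /=; field; rewrite gt_eqF.
  by [].
pose f i : gmod R := (c i * Qpi_exp R (- (rho i * mu i ^+ 2))%:C) *:
  gb (PosNum (rho0 i)) ((rho i * mu i) +i* al i).
exists (\sum_(i < n) f i) => //; apply/funext => x.
rewrite gev_sum; apply: eq_bigr => i _.
rewrite gevZ gevU Qpi_valM -mulrA; congr (_ * _).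
by rewrite (gfun_closure (PosNum (rho0 i))).
Qed.

(** Additivity of the integral requires integrability, so [bilinear_ext] does not apply directly:
    integrability and value are carried together through an induction on each argument, down to two
    basis elements. *)
Lemma gev_star a b : gev (star a b) = convolution (gev a) (gev b).
Proof.
suff h x : cintegrable (fun y => gev a y * gev b (x - y)) /\
    cintegral (fun y => gev a y * gev b (x - y)) = gev (star a b) x.
  by apply/funext => x; rewrite -(h x).2.
elim/freeg_ind_dom0: a => [|c k a _ _ IHa].
  have -> : (fun y => gev 0 y * gev b (x - y)) = fun=> 0.
    by apply/funext => y; rewrite gev0 mul0r.
  by rewrite starC star0r gev0; exact: cintegral0.
rewrite -[c]mulr1 -freegZU star_linearl gev_linear.
have -> : (fun y => gev (c *: << k >> + a) y * gev b (x - y)) =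
    (fun y => Qpi_val c * (gev << k >> y * gev b (x - y)) + gev a y * gev b (x - y)).
  by apply/funext => y; rewrite gev_linear mulrDl mulrA.
suff [h1 <-] : cintegrable (fun y => gev << k >> y * gev b (x - y)) /\
    cintegral (fun y => gev << k >> y * gev b (x - y)) =
    gev (star (<< k >> : gmod R) b) x.
  by rewrite -IHa.2; apply: cintegralL => //; case: IHa.
elim/freeg_ind_dom0: b {IHa} => [|d l b _ _ IHb].
  have -> : (fun y => gev << k >> y * gev 0 (x - y)) = fun=> 0.
    by apply/funext => y; rewrite gev0 mulr0.
  by rewrite star0r gev0; exact: cintegral0.
rewrite -[d]mulr1 -freegZU star_linearr gev_linear.
have -> : (fun y => gev << k >> y * gev (d *: << l >> + b) (x - y)) =
    (fun y => Qpi_val d * (gev << k >> y * gev << l >> (x - y)) +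
      gev << k >> y * gev b (x - y)).
  by apply/funext => y; rewrite gev_linear; ring.
suff [h1 <-] : cintegrable (fun y => gev << k >> y * gev << l >> (x - y)) /\
    cintegral (fun y => gev << k >> y * gev << l >> (x - y)) =
    gev (star (<< k >> : gmod R) << l >>) x.
  by rewrite -IHb.2; apply: cintegralL => //; case: IHb.
have -> : (fun y => gev << k >> y * gev << l >> (x - y)) =
    (fun y => gfun k y * gfun l (x - y)).
  by apply/funext => y; rewrite !gevU.
have r0 : 0 < ratr k.1%:num :> R by rewrite ltr0q.
have s0 : 0 < ratr l.1%:num :> R by rewrite ltr0q.
have [h1 h2] := convolution_cgauss (cratr R k.2) (cratr R l.2) x r0 s0.
split=> //; rewrite star_gb /gstar gevZ gevU Qpi_valM Qpi_valV Qpi_expE.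
have gE r w : gfun (r, w) x = cgauss (ratr r%:num) (cratr R w) x by [].
apply: (etrans h2) => {IHb h1 h2}; rewrite gE.
move: k.1 k.2 l.1 l.2 r0 s0 => r w t z r0 t0.
have -> : ratr r%:num + ratr t%:num = ratr (r%:num + t%:num) :> R by rewrite rmorphD.
have -> : cratr R ((w - z) ^+ 2 / (r%:num + t%:num)%:C) =
    (cratr R w - cratr R z) ^+ 2 / (ratr (r%:num + t%:num))%:C.
  by rewrite fmorph_div rmorphXn rmorphB -cratr_real.
have -> : cratr R ((w * t%:num%:C + z * r%:num%:C) / (r%:num + t%:num)%:C) =
    (cratr R w * (ratr t%:num)%:C + cratr R z * (ratr r%:num)%:C) /
      (ratr (r%:num + t%:num))%:C.
  by rewrite fmorph_div (rmorphD (cratr R)) !(rmorphM (cratr R)) -!cratr_real.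
have <- : ratr (r%:num * t%:num / (r%:num + t%:num)) =
    ratr r%:num * ratr t%:num / ratr (r%:num + t%:num) :> R.
  by rewrite fmorph_div rmorphM.
by [].
Qed.

Lemma gev_dot a b x : gev (dot a b) x = gev a x * gev b x.
Proof.
pose f (a b : gmod R) : complex_over_Qpi := gev (dot a b) x.
pose g (a b : gmod R) : complex_over_Qpi := gev a x * gev b x.
rewrite -[LHS]/(f a b) -[RHS]/(g a b).
move: a b; apply: (@bilinear_ext (Qpi R) gkey complex_over_Qpi f g).
- by move=> b c a a'; rewrite /f dot_linearl gev_linear.
- by move=> a c b b'; rewrite /f dot_linearr gev_linear.
- by move=> b c a a'; rewrite /g gev_linear mulrDl -mulrA.
- by move=> a c b b'; rewrite /g gev_linear mulrDr mulrCA.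
move=> [r w] [s z]; rewrite /f /g dot_gb !gevU /gfun /cgauss -cexpD /=; congr cexp.
rewrite [ratr _]rmorphD (rmorphD (real_complex R)) (rmorphD (cratr R)) /=.
by move: (pi%:C : R[i]) => p; ring.
Qed.

Lemma gev_pos mu a x : gev (hact (heis_pos R mu) a) x = gev a (x - ratr mu).
Proof.
pose f a : complex_over_Qpi := gev (hact (heis_pos R mu) a) x.
pose g a : complex_over_Qpi := gev a (x - ratr mu).
rewrite -[LHS]/(f a) -[RHS]/(g a); move: a.
apply: (@freeg_linear_ext (Qpi R) gkey complex_over_Qpi f g).
- by move=> c a b; rewrite /f hact_linear gev_linear.
- by move=> c a b; rewrite /g gev_linear.
have gE s z y : gfun (s, z) y = cgauss (ratr s%:num) (cratr R z) y by [].
move=> [r w]; rewrite /f /g hact_pos_gb gevZ !gevU Qpi_expE !gE /cgauss -cexpD.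
congr cexp; have cM w' z : cratr R (w' * z) = cratr R w' * cratr R z by exact: rmorphM.
have cD w' z : cratr R (w' + z) = cratr R w' + cratr R z by exact: rmorphD.
have -> : cratr R (- ((2 * w + (r%:num * mu)%:C) * mu%:C)) =
    - ((2 * cratr R w + cratr R (r%:num * mu)%:C) * cratr R mu%:C).
  by rewrite [LHS]rmorphN /= cM cD cM [cratr R 2]rmorph_nat.
rewrite cD !cratr_real [ratr (_ * _)]rmorphM.
rewrite (rmorphB (real_complex R)) (rmorphM (real_complex R)) /=.
by move: (pi%:C : R[i]) => p; ring.
Qed.

Lemma gev_freq al a x : gev (hact (heis_freq R al) a) x = etau (ratr al * x) * gev a x.
Proof.
pose f a : complex_over_Qpi := gev (hact (heis_freq R al) a) x.
pose g a : complex_over_Qpi := etau (ratr al * x) * gev a x.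
rewrite -[LHS]/(f a) -[RHS]/(g a); move: a.
apply: (@freeg_linear_ext (Qpi R) gkey complex_over_Qpi f g).
- by move=> c a b; rewrite /f hact_linear gev_linear.
- by move=> c a b; rewrite /g gev_linear mulrDr mulrCA.
move=> [r [a b]]; rewrite /f /g hact_freq_gb !gevU !gfunE /=.
by rewrite addr0 rmorphD mulrDl etauD; ring.
Qed.

Lemma gev_gunit : gev (gunit R) = @unit_gaussian R.
Proof.
apply/funext => x; rewrite gevU gfunE /= rmorph0 mul0r etau0 mulr1 /unit_gaussian.
by rewrite rmorph1 /gexp mulr0 mul0r sub0r mul1r mulrN.
Qed.

Lemma gev_gaussian_closure : is_gaussian_closure gev.
Proof.
split; [exact: gev_inj|exact: gev_range|exact: gev_linear|exact: gev_star
  |exact: gev_dot|exact: gev_pos|exact: gev_freq].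
Qed.

End Evaluation.

Theorem theorem76 (R : realType) (T : twainType R) (u : T)
    (Tfree : is_free_twain u) :
  exists (B : twainType R) (ev : B -> R -> complex R),
    is_gaussian_closure ev /\
    exists phi : twain_quot (twain_gen (gaussian_relations u)) -> B,
      [/\ twain_morphism phi, bijective phi
        & ev (phi (twain_proj (twain_gen (gaussian_relations u)) u))
          = @unit_gaussian R].
Proof.
exists (gmod R), (@gev R); split; first exact: gev_gaussian_closure.
have [phi [phim phib phiu]] := presentation_bijective Tfree.
by exists phi; split=> //; rewrite phiu gev_gunit.
Qed.
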